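(* There exist Bryant spheres with an arbitrary number of smooth ends; that is, for every positive integer $m$ there exists a Bryant sphere with exactly $m$ smooth ends.
   Context: Let $\mathbf{B}^3=\{x\in\mathbb{R}^3: |x|<1\}$ with the metric $\frac{4|dx|^2}{(1-|x|^2)^2}$ (Poincaré ball model of hyperbolic space). A Bryant surface is a conformally immersed Riemann surface in $\mathbf{B}^3$ with constant mean curvature $1$. A smooth Bryant end is a Bryant surface $E\subset \mathbf{B}^3$ for which there is a point $p_\infty\in\partial\mathbf{B}^3$ such that $E\cup\{p_\infty\}$ is a conformally immersed open disc in $\mathbb{R}^3$ (i.e. $E$ is parametrized on the punctured disc and the parametrization extends to a smooth conformal immersion of the disc into $\mathbb{R}^3$ sending the puncture to $p_\infty$). A Bryant sphere with smooth ends is a Bryant surface that is conformally equivalent to $\mathbb{CP}^1$ minus a finite number of points such that each of these points (the ends) has a punctured neighborhood that is a smooth Bryant end. *)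

(* Defs.v *)
From mathcomp Require Export all_boot all_order all_algebra.
From mathcomp Require Export finmap complex.
From mathcomp Require Export all_classical all_reals all_analysis.

Set Implicit Arguments.
Unset Strict Implicit.
Unset Printing Implicit Defensive.

Import Order.TTheory GRing.Theory Num.Theory.
Import numFieldNormedType.Exports.

Local Open Scope classical_set_scope.
Local Open Scope ring_scope.

(** C^k and smooth maps on a set [U] of R^d. These notions are the usual ones
    only when [U] is open, and are only used for such [U]. *)
Section Smoothness.
Context {R : realType} {d n : nat}.
Implicit Types (U : set 'rV[R]_d) (f : 'rV[R]_d -> 'rV[R]_n).

Fixpoint C_k (k : nat) U f : Prop :=
  (forall u, U u -> {for u, continuous f}) /\
  if k is k'.+1 then
    forall a : 'I_d, (forall u, U u -> derivable f u 'e_a) /\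
                     C_k k' U ('D_('e_a) f)
  else True.

Definition smooth U f : Prop := forall k, C_k k U f.

End Smoothness.

(** A Riemannian metric on (an open part of) R^n is given by its matrix
    [g x] in the standard coordinates. *)
Section RiemannianGeometry.
Context {R : realType} {n : nat}.
Implicit Types (g : 'rV[R]_n -> 'M[R]_n) (x v w : 'rV[R]_n).

Definition inner g x v w : R := (v *m g x *m w^T) 0 0.

(** The Christoffel symbol [Gamma^k_(i j)] of the Levi-Civita connection. *)
Definition christoffel g x (k i j : 'I_n) : R :=
  2^-1 * \sum_(l < n) invmx (g x) k l *
    ('D_('e_i) (fun y => g y j l) x + 'D_('e_j) (fun y => g y i l) x
     - 'D_('e_l) (fun y => g y i j) x).

Context {d : nat}.
Implicit Types (U : set 'rV[R]_d) (f : 'rV[R]_d -> 'rV[R]_n) (u : 'rV[R]_d).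

(** Coordinates of the covariant derivative of the field [d_b f] along [f]
    in the direction of the [a]-th parameter. *)
Definition covariant g f u (a b : 'I_d) : 'rV[R]_n :=
  \row_k ('D_('e_a) ('D_('e_b) f) u 0 k +
          \sum_(i < n) \sum_(j < n) christoffel g (f u) k i j *
            'D_('e_a) f u 0 i * 'D_('e_b) f u 0 j).

Definition first_form g f u : 'M[R]_d :=
  \matrix_(a, b) inner g (f u) ('D_('e_a) f u) ('D_('e_b) f u).

Definition second_form g f (N : 'rV[R]_n) u : 'M[R]_d :=
  \matrix_(a, b) inner g (f u) (covariant g f u a b) N.

(** The induced metric is a positive multiple of [|du|^2]; in particular
    the differential of [f] is injective. *)
Definition conformal_immersion g U f : Prop :=
  smooth U f /\
  forall u, U u -> exists2 c : R, 0 < c & first_form g f u = c%:M.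

End RiemannianGeometry.

Section Surfaces.
Context {R : realType}.
Implicit Types (g : 'rV[R]_3 -> 'M[R]_3) (f : 'rV[R]_2 -> 'rV[R]_3).
Implicit Types (U : set 'rV[R]_2) (u : 'rV[R]_2) (N : 'rV[R]_3).

(** The unit normal [N] for which [(f_x, f_y, N)] is positively oriented. *)
Definition unit_normal g f u N : Prop :=
  [/\ inner g (f u) N N = 1,
      forall a : 'I_2, inner g (f u) ('D_('e_a) f u) N = 0 &
      0 < \det (col_mx (col_mx ('D_('e_0) f u) ('D_('e_1) f u)) N
                : 'M[R]_(1 + 1 + 1))].

(** Half the trace of the second fundamental form with respect to the
    induced metric. *)
Definition mean_curvature g f N u : R :=
  2^-1 * \tr (invmx (first_form g f u) *m second_form g f N u).

End Surfaces.

Section BryantSurfaces.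
Variable R : realType.

Definition sqnorm {n} (x : 'rV[R]_n) : R := \sum_i x 0 i ^+ 2.

Definition euclidean_metric (x : 'rV[R]_3) : 'M[R]_3 := 1%:M.

Definition poincare_metric (x : 'rV[R]_3) : 'M[R]_3 :=
  (4 / (1 - sqnorm x) ^+ 2)%:M.

(** A Bryant surface parametrized by an open subset [U] of the complex plane
    (with [f] arbitrary outside [U]). *)
Definition bryant (U : set 'rV[R]_2) (f : 'rV[R]_2 -> 'rV[R]_3) : Prop :=
  [/\ forall u, U u -> sqnorm (f u) < 1,
      conformal_immersion poincare_metric U f &
      forall u, U u -> exists2 N, unit_normal poincare_metric f u N &
                                  mean_curvature poincare_metric f N u = 1].

Definition disc : set 'rV[R]_2 := [set u | sqnorm u < 1].
Definition punctured_disc : set 'rV[R]_2 := disc `\ 0.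

Definition smooth_bryant_end (e : 'rV[R]_2 -> 'rV[R]_3) : Prop :=
  bryant punctured_disc e /\
  exists2 p : 'rV[R]_3, sqnorm p = 1 &
    conformal_immersion euclidean_metric disc
      (fun u => if u == 0 then p else e u).

(** The Riemann sphere: [Some z] is the point [z] and [None] is the point at
    infinity. Its complex structure is given by the two charts [z] and [1/z],
    whose inverses are [param false] and [param true]. *)
Definition CP1 : choiceType := option R[i].

Definition param (at_infty : bool) (z : R[i]) : CP1 :=
  if at_infty then (if z == 0 then None else Some z^-1) else Some z.

Definition to_complex (u : 'rV[R]_2) : R[i] := (u 0 0 +i* u 0 1)%C.

(** [f] restricted to the complement of [S] is a Bryant sphere, and each point
    [p] of [S] has a punctured coordinate disc (of center [p] and radius [r] in
    one of the charts, rescaled to the unit disc) on which [f] is a smooth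
    Bryant end. The values of [f] on [S] are irrelevant. *)
Definition bryant_sphere_smooth_ends (S : {fset CP1})
    (f : CP1 -> 'rV[R]_3) : Prop :=
  (forall b, bryant [set u | param b (to_complex u) \notin S]
                    (fun u => f (param b (to_complex u)))) /\
  (forall p, p \in S -> exists (b : bool) (a : 'rV[R]_2) (r : R),
     [/\ 0 < r, param b (to_complex a) = p,
         forall u, punctured_disc u ->
           param b (to_complex (a + r *: u)) \notin S &
         smooth_bryant_end (fun u => f (param b (to_complex (a + r *: u))))]).

End BryantSurfaces.

(* Main.v *)
Require Import Defs.
From mathcomp Require Import separable cyclotomic.
From mathcomp Require Import ring zify.

(** The surfaces come from Bryant's representation: if [F] is a holomorphic map
    into SL_2(C) with det F' = 0 (a null curve), then F F^H, read in the
    hyperboloid of positive hermitian matrices of determinant 1, has mean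
    curvature 1. Here ^H is the conjugate transpose.

    Write F = A / r with a polynomial matrix [A] and a polynomial [r]. The two
    conditions on [F] become det A = r^2 and det A' = r'^2 ([null_curve]), and
    in the Poincare ball the surface is the vector part of A A^H divided by
    E = tr (A A^H) + 2 |r|^2 ([surface]); multiplying [A] and [r] by the same
    function does not change it. This formula is smooth wherever [A] does not
    vanish, and 1 - |x|^2 = 4 |r|^2 / E ([sqnorm_surface]) says that exactly the
    zeros of [r] are sent to the ideal boundary. With the polynomial matrix
    M = adj(A) A' - r r' (which is r^2 F^-1 F') the Euclidean first fundamental
    form is 4 |M|^2 / E^2 times the identity ([dot_surface]), at the zeros of
    [r] as elsewhere. So, when neither [A] nor [M] has a zero, the zeros of [r]
    are smooth ends and the rest is a Bryant surface ([bryant_surface]). A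
    Bryant sphere with smooth ends is therefore given by such data in z and in
    1/z that agree up to a factor ([sphere_of_null_curves]), and its ends are
    the zeros of [r].

    For a polynomial s and a primitive k of s'^2, the matrix with rows
    (z, k z - s^2) and (1, k), with r = s, satisfies the two determinant
    conditions. Taking s = 1 gives a horosphere, with one end at infinity.
    Taking s = z^n - eps with n >= 2 gives one end at each root of s and one at
    infinity ([null_curve_binomial_matrix]): two ends for z^2 (a catenoid
    cousin), n + 1 ends for z^n - 1.

    The mean curvature needs scalar products of A A^H, its first derivatives,
    its Laplacian and the null direction of the normal. All of them are Lorentz
    products of hermitian matrices, and [dot_pauli] reduces them to the products
    adj(A) A = r^2, adj(A) A' = r r' + M, adj(A') A = r r' - M and
    adj(A') A' = r'^2. *)

Set Implicit Arguments.
Unset Strict Implicit.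
Unset Printing Implicit Defensive.

Import Order.TTheory GRing.Theory Num.Theory.
Import numFieldNormedType.Exports.

Local Open Scope classical_set_scope.
Local Open Scope ring_scope.

(** * Real and imaginary parts of complex polynomials *)

Section ComplexParts.
Context {R : realType}.
Implicit Types x y : R[i].

Lemma Re_complexD x y : complex.Re (x + y) = complex.Re x + complex.Re y.
Proof. by case: x; case: y. Qed.

Lemma Im_complexD x y : complex.Im (x + y) = complex.Im x + complex.Im y.
Proof. by case: x; case: y. Qed.

Lemma Re_complexM x y : complex.Re (x * y) =
  complex.Re x * complex.Re y - complex.Im x * complex.Im y.
Proof. by case: x; case: y. Qed.

Lemma Im_complexM x y : complex.Im (x * y) =
  complex.Re x * complex.Im y + complex.Im x * complex.Re y.
Proof. by case: x; case: y. Qed.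

End ComplexParts.

Section PolynomialCalculus.
Context {R : realType}.
Implicit Types (p q : {poly R[i]}) (u : 'rV[R]_2) (a : 'I_2).

(** The coordinate directions of the plane as complex numbers: the derivative
    of p(x + i y) is p' along x and i p' along y. *)
Definition unit_dir a : R[i] := if a == 0 then 1 else 'i%C.

Definition pdir a p : {poly R[i]} := unit_dir a *: p^`().

Lemma is_derive_coord n (u : 'rV[R]_n) (a i : 'I_n) :
  is_derive u ('e_a : 'rV[R]_n) (fun v : 'rV[R]_n => v 0 i) ((i == a)%:R).
Proof.
have /(derivable_mxP _ _ _).1 h := @derivable_id R 'rV[R]_n u 'e_a.
apply: DeriveDef; first exact: h.
have := @derive_id R 'rV[R]_n u 'e_a.
rewrite derive_mx; last exact: derivable_id.
by move/rowP/(_ i); rewrite !mxE eqxx.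
Qed.

Lemma continuous_re_im_horner p :
  continuous (fun u => complex.Re p.[to_complex u]) /\
  continuous (fun u => complex.Im p.[to_complex u]).
Proof.
have cc i : continuous (fun u : 'rV[R]_2 => u 0 i) by exact: coord_continuous.
elim/poly_ind: p => [|p c [IHr IHi]].
  split; rewrite (_ : (fun _ => _) = cst 0); try exact: cst_continuous.
    by apply/funext => u; rewrite horner0.
  by apply/funext => u; rewrite horner0.
split => u.
- rewrite (_ : (fun _ => _) =
      (fun u => complex.Re p.[to_complex u]) * (fun u => u 0 0)
    - (fun u => complex.Im p.[to_complex u]) * (fun u => u 0 1)
    + cst (complex.Re c)); last first.
    by apply/funext => v; rewrite hornerMXaddC Re_complexD Re_complexM.
  by apply: continuousD; [apply: continuousB; apply: continuousM
    ; (exact: IHr || exact: IHi || exact: cc)|exact: cst_continuous].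
- rewrite (_ : (fun _ => _) =
      (fun u => complex.Re p.[to_complex u]) * (fun u => u 0 1)
    + (fun u => complex.Im p.[to_complex u]) * (fun u => u 0 0)
    + cst (complex.Im c)); last first.
    by apply/funext => v; rewrite hornerMXaddC Im_complexD Im_complexM.
  by apply: continuousD; [apply: continuousD; apply: continuousM
    ; (exact: IHr || exact: IHi || exact: cc)|exact: cst_continuous].
Qed.

Lemma is_derive_re_im_horner p u a :
  is_derive u ('e_a : 'rV[R]_2) (fun v => complex.Re p.[to_complex v])
    (complex.Re (pdir a p).[to_complex u]) /\
  is_derive u ('e_a : 'rV[R]_2) (fun v => complex.Im p.[to_complex v])
    (complex.Im (pdir a p).[to_complex u]).
Proof.
elim/poly_ind: p => [|p c [IHr IHi]].
  rewrite /pdir deriv0 scaler0 horner0.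
  split; (rewrite (_ : (fun _ => _) = cst 0);
    [exact: is_derive_cst|by apply/funext => v; rewrite horner0]).
have c0 := is_derive_coord u a 0; have c1 := is_derive_coord u a 1.
have e : (pdir a (p * 'X + c%:P)).[to_complex u] =
    (pdir a p).[to_complex u] * to_complex u + unit_dir a * p.[to_complex u].
  rewrite /pdir derivD derivM derivX derivC !hornerE; ring.
rewrite e; split.
- rewrite (_ : (fun _ => _) = (fun u => complex.Re p.[to_complex u]) * (fun u => u 0 0)
    - (fun u => complex.Im p.[to_complex u]) * (fun u => u 0 1)
     + cst (complex.Re c)); last first.
    by apply/funext => v; rewrite hornerMXaddC Re_complexD Re_complexM.
  apply: is_derive_eq; rewrite Re_complexD !Re_complexM /unit_dir /= /GRing.scale /=.
  by case: a {IHr IHi c0 c1 e} => [] [|[|//]] i /=; ring.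
- rewrite (_ : (fun _ => _) = (fun u => complex.Re p.[to_complex u]) * (fun u => u 0 1)
    + (fun u => complex.Im p.[to_complex u]) * (fun u => u 0 0)
     + cst (complex.Im c)); last first.
    by apply/funext => v; rewrite hornerMXaddC Im_complexD Im_complexM.
  have h := is_deriveD (is_deriveD (is_deriveM IHr c1) (is_deriveM IHi c0))
    (is_derive_cst (complex.Im c) u ('e_a)).
  apply: is_derive_eq h _; rewrite Im_complexD !Im_complexM /unit_dir /= /GRing.scale /=.
  by case: a {IHr IHi c0 c1 e} => [] [|[|//]] i /=; ring.
Qed.

(** A class of functions that contains the real and imaginary parts of
    polynomials, is closed under partial derivatives and consists of
    continuous functions; its members are smooth by induction on the order. *)
Inductive re_rational : ('rV[R]_2 -> R) -> Prop :=
| re_rational_Re p : re_rational (fun u => complex.Re p.[to_complex u])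
| re_rational_Im p : re_rational (fun u => complex.Im p.[to_complex u])
| re_rationalD f g : re_rational f -> re_rational g -> re_rational (f + g)
| re_rationalM f g : re_rational f -> re_rational g -> re_rational (f * g)
| re_rationalV f : re_rational f -> (forall u, f u != 0) ->
    re_rational (fun u => (f u)^-1).

Lemma re_rational_cst c : re_rational (cst c).
Proof.
rewrite (_ : cst c = fun u => complex.Re (c%:C%C%:P).[to_complex u]).
  exact: re_rational_Re.
by apply/funext => u; rewrite hornerC.
Qed.

Lemma re_rational_continuous f : re_rational f -> continuous f.
Proof.
elim=> [p|p|g h _ IHg _ IHh|g h _ IHg _ IHh|g _ IHg g0].
- exact: (continuous_re_im_horner p).1.
- exact: (continuous_re_im_horner p).2.
- by move=> u; apply: continuousD; [exact: IHg|exact: IHh].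
- by move=> u; apply: continuousM; [exact: IHg|exact: IHh].
- by move=> u; apply: continuousV => //; exact: IHg.
Qed.

(** The derivative of 1/g is - (1/g) (1/g) g', which again belongs to the
    class because 1/g does. *)
Lemma re_rational_derive f : re_rational f -> forall a : 'I_2,
  (forall u, derivable f u 'e_a) /\ re_rational ('D_('e_a) f).
Proof.
elim=> [p|p|g h Sg IHg Sh IHh|g h Sg IHg Sh IHh|g Sg IHg g0] a.
- have D u := (is_derive_re_im_horner p u a).1.
  split => [u|]; first exact: ex_derive.
  rewrite (_ : 'D_('e_a) _ = fun u => complex.Re (pdir a p).[to_complex u]).
    exact: re_rational_Re.
  by apply/funext => u; exact: derive_val.
- have D u := (is_derive_re_im_horner p u a).2.
  split => [u|]; first exact: ex_derive.
  rewrite (_ : 'D_('e_a) _ = fun u => complex.Im (pdir a p).[to_complex u]).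
    exact: re_rational_Im.
  by apply/funext => u; exact: derive_val.
- have [dg Sdg] := IHg a; have [dh Sdh] := IHh a.
  split => [u|]; first exact: derivableD.
  rewrite (_ : 'D_('e_a) _ = 'D_('e_a) g + 'D_('e_a) h).
    exact: re_rationalD.
  by apply/funext => u; rewrite deriveD.
- have [dg Sdg] := IHg a; have [dh Sdh] := IHh a.
  split => [u|]; first exact: derivableM.
  rewrite (_ : 'D_('e_a) _ = g * 'D_('e_a) h + h * 'D_('e_a) g).
    by apply: re_rationalD; apply: re_rationalM.
  by apply/funext => u; rewrite deriveM.
- have [dg Sdg] := IHg a.
  split => [u|]; first exact: derivableV.
  rewrite (_ : 'D_('e_a) _ = cst (- 1) * ((fun u => (g u)^-1) * (fun u => (g u)^-1))
                * 'D_('e_a) g).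
    apply: re_rationalM => //; apply: re_rationalM; first exact: re_rational_cst.
    by apply: re_rationalM; exact: re_rationalV.
  apply/funext => u; rewrite deriveV// /GRing.scale /= mulN1r.
  by rewrite expr2 invfM.
Qed.

Lemma continuous_row n (f : 'rV[R]_2 -> 'rV[R]_n) u :
  (forall i, {for u, continuous (fun v => f v 0 i)}) -> {for u, continuous f}.
Proof.
move=> cf; apply/(@cvgrPdist_le _ _ _ (nbhs u) _ f) => /= e e0; near=> x.
rewrite /Num.Def.normr/= mx_normrE (bigmax_le _ (ltW e0))//= => -[i j] _.
rewrite !mxE/= ord1.
move: j; near: x; apply: filter_forall => /= j.
exact: (cvgrPdist_le _ _).1 (cf j) e e0.
Unshelve. all: by end_near. Qed.

Lemma smooth_re_rational n (U : set 'rV[R]_2) (f : 'rV[R]_2 -> 'rV[R]_n) :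
  (forall i, re_rational (fun u => f u 0 i)) -> smooth U f.
Proof.
move=> Sf k; elim: k f Sf => [|k IH] f Sf.
all: have cf u : {for u, continuous f} by
  apply: continuous_row => i; exact: re_rational_continuous (Sf i) u.
  by split.
split => // a.
have df u : derivable f u 'e_a.
  by apply/derivable_mxP => i j; rewrite ord1; exact: (re_rational_derive (Sf j) a).1.
split => //; apply: IH => i.
rewrite (_ : (fun u => _) = 'D_('e_a) (fun u => f u 0 i)).
  exact: (re_rational_derive (Sf i) a).2.
by apply/funext => u; rewrite derive_mx // mxE.
Qed.

End PolynomialCalculus.

(** * Scalar and triple products in dimension three *)

Section Rows3.
Context {R : comNzRingType}.
Implicit Types x y z : 'rV[R]_3.

Definition row3 (a b c : R) : 'rV[R]_3 :=
  \row_i nth 0 [:: a; b; c] i.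

Definition dot x y : R := x 0 0 * y 0 0 + x 0 1 * y 0 1 + x 0 2%:R * y 0 2%:R.

Lemma dotE x y : dot x y = \sum_i x 0 i * y 0 i.
Proof.
rewrite !big_ord_recl big_ord0 addr0 /dot addrA.
by congr (_ + _ * _ + _ * _); congr (_ _ _); apply/val_inj.
Qed.

Lemma dotC x y : dot x y = dot y x.
Proof. by rewrite /dot; ring. Qed.

Lemma dotDl x y z : dot (x + y) z = dot x z + dot y z.
Proof. by rewrite /dot !mxE; ring. Qed.

Lemma dotZl a x y : dot (a *: x) y = a * dot x y.
Proof. by rewrite /dot !mxE; ring. Qed.

Lemma dotNl x y : dot (- x) y = - dot x y.
Proof. by rewrite -scaleN1r dotZl mulN1r. Qed.

Lemma dotDr x y z : dot z (x + y) = dot z x + dot z y.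
Proof. by rewrite dotC dotDl !(dotC z). Qed.

Lemma dotZr a x y : dot y (a *: x) = a * dot y x.
Proof. by rewrite dotC dotZl (dotC y). Qed.

Lemma dotNr x y : dot y (- x) = - dot y x.
Proof. by rewrite dotC dotNl (dotC y). Qed.

Definition dot_lin := (dotDl, dotDr, dotZl, dotZr, dotNl, dotNr).

Definition det3 x y z : R :=
  x 0 0 * (y 0 1 * z 0 2%:R - y 0 2%:R * z 0 1)
  - x 0 1 * (y 0 0 * z 0 2%:R - y 0 2%:R * z 0 0)
  + x 0 2%:R * (y 0 0 * z 0 1 - y 0 1 * z 0 0).

(** Rewriting the entries as the values of a list of lists makes the indices
    of the iterated minors compute. *)
Lemma det_col_mx3 x y z :
  \det (col_mx (col_mx x y) z : 'M[R]_(1 + 1 + 1)) = det3 x y z.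
Proof.
set A := (col_mx _ _ : 'M[R]_(1 + 1 + 1)).
have eA (i j : 'I_3) : A i j = nth 0 (nth [::]
    [:: [:: x 0 0; x 0 1; x 0 2%:R]; [:: y 0 0; y 0 1; y 0 2%:R];
        [:: z 0 0; z 0 1; z 0 2%:R]] i) j.
  have ej (w : 'rV[R]_3) : w 0 j = nth 0 [:: w 0 0; w 0 1; w 0 2%:R] j.
    case: j => [[|[|[|//]]]] lj /=; congr (w 0 _); exact/val_inj.
  case: i => [[|[|[|//]]]] li; rewrite /= -ej.
  - rewrite (_ : Ordinal li = lshift 1 (lshift 1 (0 : 'I_1))); last exact/val_inj.
    by rewrite /A !col_mxEu.
  - rewrite (_ : Ordinal li = lshift 1 (rshift 1 (0 : 'I_1))); last exact/val_inj.
    by rewrite /A col_mxEu col_mxEd.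
  - rewrite (_ : Ordinal li = rshift (1 + 1) (0 : 'I_1)); last exact/val_inj.
    by rewrite /A col_mxEd.
move: A eA => A eA.
rewrite (expand_det_row _ 0) !big_ord_recl big_ord0 /cofactor.
rewrite !(expand_det_row _ 0) !big_ord_recl !big_ord0 /cofactor !det_mx11 !mxE.
by rewrite !eA /det3 /= /bump /=; ring.
Qed.

End Rows3.

(** * Hermitian matrices and jets of null curves *)

Record mat2 (T : Type) := Mat2 { m11 : T; m12 : T; m21 : T; m22 : T }.

Section Mat2.
Context {K : comNzRingType}.
Implicit Types A B : mat2 K.

Definition det2 A : K := m11 A * m22 A - m12 A * m21 A.

Definition scale2 (k : K) A : mat2 K :=
  Mat2 (k * m11 A) (k * m12 A) (k * m21 A) (k * m22 A).

(** The product adj(A) B. *)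
Definition adjmul A B : mat2 K :=
  Mat2 (m22 A * m11 B - m12 A * m21 B) (m22 A * m12 B - m12 A * m22 B)
       (m11 A * m21 B - m21 A * m11 B) (m11 A * m22 B - m21 A * m12 B).

Lemma adjmulK A B : scale2 (det2 A) B =
  Mat2 (m11 A * m11 (adjmul A B) + m12 A * m21 (adjmul A B))
       (m11 A * m12 (adjmul A B) + m12 A * m22 (adjmul A B))
       (m21 A * m11 (adjmul A B) + m22 A * m21 (adjmul A B))
       (m21 A * m12 (adjmul A B) + m22 A * m22 (adjmul A B)).
Proof. by rewrite /scale2 /det2 /=; congr Mat2; ring. Qed.

Lemma adjmul_scalel k A B : adjmul (scale2 k A) B = scale2 k (adjmul A B).
Proof. by rewrite /adjmul /scale2 /=; congr Mat2; ring. Qed.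

Lemma adjmul_scaler k A B : adjmul A (scale2 k B) = scale2 k (adjmul A B).
Proof. by rewrite /adjmul /scale2 /=; congr Mat2; ring. Qed.

End Mat2.

Section Hermitian.
Context {R : realType}.
Implicit Types (x y r : R[i]) (A B C D : mat2 R[i]).

(** The real part of x times the conjugate of y. *)
Definition cdot x y : R :=
  complex.Re x * complex.Re y + complex.Im x * complex.Im y.

(** The imaginary part of x times the conjugate of y. *)
Definition cwedge x y : R :=
  complex.Im x * complex.Re y - complex.Re x * complex.Im y.

Definition gram A B : R :=
  cdot (m11 A) (m11 B) + cdot (m12 A) (m12 B)
  + cdot (m21 A) (m21 B) + cdot (m22 A) (m22 B).

(** Let H = (A B^H + B A^H) / 2, a hermitian matrix with entries h_ij. Then
    [gram A B] is tr H, and [pauli A B] is (2 Re h_12, 2 Im h_12, h_11 -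
    h_22), so that [gram] squared minus the square of [pauli] is 4 det H. *)
Definition pauli A B : 'rV[R]_3 := row3
  (cdot (m11 A) (m21 B) + cdot (m12 A) (m22 B)
   + cdot (m11 B) (m21 A) + cdot (m12 B) (m22 A))
  (cwedge (m11 A) (m21 B) + cwedge (m12 A) (m22 B)
   + cwedge (m11 B) (m21 A) + cwedge (m12 B) (m22 A))
  (cdot (m11 A) (m11 B) + cdot (m12 A) (m12 B)
   - cdot (m21 A) (m21 B) - cdot (m22 A) (m22 B)).

Lemma cdot_ge0 x : 0 <= cdot x x.
Proof. by rewrite /cdot -!expr2 addr_ge0 ?sqr_ge0. Qed.

Lemma cdot_gt0 x : x != 0 -> 0 < cdot x x.
Proof.
move=> x0; rewrite lt0r cdot_ge0 andbT /cdot -!expr2 paddr_eq0 ?sqr_ge0//.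
by rewrite !sqrf_eq0; apply: contraNN x0; rewrite eq_complex.
Qed.

Lemma gram_ge0 A : 0 <= gram A A.
Proof.
exact: (addr_ge0 (addr_ge0 (addr_ge0 (cdot_ge0 _) (cdot_ge0 _)) (cdot_ge0 _))
  (cdot_ge0 _)).
Qed.

Lemma gram_eq0 A : gram A A = 0 ->
  [/\ m11 A = 0, m12 A = 0, m21 A = 0 & m22 A = 0].
Proof.
have c0 x : cdot x x = 0 -> x = 0.
  move=> cx; apply/eqP; rewrite -[_ == _]negbK; apply/negP => /cdot_gt0.
  by rewrite cx ltxx.
have c := cdot_ge0.
move=> /eqP; rewrite /gram (paddr_eq0 (addr_ge0 (addr_ge0 (c _) (c _)) (c _)) (c _)).
rewrite (paddr_eq0 (addr_ge0 (c _) (c _)) (c _)) (paddr_eq0 (c _) (c _)).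
by move=> /andP[/andP[/andP[]]] /eqP/c0 ? /eqP/c0 ? /eqP/c0 ? /eqP/c0 ?.
Qed.

(** The polarized determinant of hermitian matrices is tr (adj(H) K) up to a
    factor; for H = A B^H and K = C D^H it is the Frobenius product of adj(A)
    C and adj(B) D. *)
Lemma dot_pauli A B C D : dot (pauli A B) (pauli C D) =
  gram A B * gram C D
  - (gram (adjmul A C) (adjmul B D) + gram (adjmul A D) (adjmul B C)).
Proof.
rewrite /gram /dot !mxE /= /cdot /cwedge.
case: A => [] [? ?] [? ?] [? ?] [? ?]; case: B => [] [? ?] [? ?] [? ?] [? ?].
case: C => [] [? ?] [? ?] [? ?] [? ?]; case: D => [] [? ?] [? ?] [? ?] [? ?].
rewrite /=; ring.
Qed.

Lemma gram_scale (k k' : R[i]) A : gram (scale2 k A) (scale2 k' A) = cdot k k' * gram A A.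
Proof.
rewrite /gram /= /cdot; case: A => [] [? ?] [? ?] [? ?] [? ?].
by case: k k' => ? ? [? ?] /=; ring.
Qed.

Lemma pauli_scale (k : R[i]) A : pauli (scale2 k A) (scale2 k A) = cdot k k *: pauli A A.
Proof.
apply/rowP; case; case=> [|[|[|//]]] ?; rewrite !mxE /= /cdot /cwedge;
by case: A => [] [? ?] [? ?] [? ?] [? ?]; case: k => ? ? /=; ring.
Qed.

End Hermitian.

Section NullJet.
Context {R : realType}.
Variables (A A1 : mat2 R[i]) (r r1 : R[i]).
Implicit Types (x y : R[i]) (B C D E : mat2 R[i]).

(** The values A, A1, r, r1 of A, A', r, r' at a point; the last equation is
    the derivative of det A = r^2. *)
Definition null_jet : Prop :=
  [/\ det2 A = r ^+ 2, det2 A1 = r1 ^+ 2 &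
      m11 (adjmul A A1) + m22 (adjmul A A1) = 2 * r * r1].

(** r^2 F^-1 F' for F = A / r, which has trace and determinant 0. *)
Definition maurer : mat2 R[i] :=
  Mat2 (m11 (adjmul A A1) - r * r1) (m12 (adjmul A A1))
       (m21 (adjmul A A1)) (m22 (adjmul A A1) - r * r1).

(** r^2 F' for F = A / r. It has rank at most one, and its image is the null
    line of the hyperbolic Gauss map. *)
Definition wronsk : mat2 R[i] :=
  Mat2 (r * m11 A1 - r1 * m11 A) (r * m12 A1 - r1 * m12 A)
       (r * m21 A1 - r1 * m21 A) (r * m22 A1 - r1 * m22 A).

Hypothesis jet : null_jet.

Lemma maurer_traceless : m22 maurer = - m11 maurer.
Proof.
case: jet => _ _ h; apply/eqP; rewrite -addr_eq0 /=; apply/eqP.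
by transitivity (m11 (adjmul A A1) + m22 (adjmul A A1) - 2 * r * r1);
  [rewrite /=; ring|rewrite h; ring].
Qed.

Let m := m11 maurer.
Let n := m12 maurer.
Let k := m21 maurer.

Lemma maurerE : maurer = Mat2 m n k (- m).
Proof. by rewrite -maurer_traceless. Qed.

Lemma adjmulAA : adjmul A A = Mat2 (r ^+ 2) 0 0 (r ^+ 2).
Proof. case: jet => <- _ _; rewrite /adjmul /det2; congr Mat2; ring. Qed.

Lemma adjmulA1A1 : adjmul A1 A1 = Mat2 (r1 ^+ 2) 0 0 (r1 ^+ 2).
Proof. case: jet => _ <- _; rewrite /adjmul /det2; congr Mat2; ring. Qed.

Lemma adjmulAA1 : adjmul A A1 = Mat2 (r * r1 + m) n k (r * r1 - m).
Proof. by rewrite -maurer_traceless /adjmul /=; congr Mat2; rewrite /m /=; ring. Qed.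

Lemma adjmulA1A : adjmul A1 A = Mat2 (r * r1 - m) (- n) (- k) (r * r1 + m).
Proof. by rewrite -maurer_traceless /adjmul; congr Mat2; rewrite /m /n /k /=; ring. Qed.

Lemma adjmul_wronsk B : adjmul B wronsk =
  Mat2 (r * m11 (adjmul B A1) - r1 * m11 (adjmul B A))
       (r * m12 (adjmul B A1) - r1 * m12 (adjmul B A))
       (r * m21 (adjmul B A1) - r1 * m21 (adjmul B A))
       (r * m22 (adjmul B A1) - r1 * m22 (adjmul B A)).
Proof. by rewrite /adjmul /=; congr Mat2; ring. Qed.

Lemma adjmulAW : adjmul A wronsk = scale2 r maurer.
Proof.
by rewrite adjmul_wronsk adjmulAA adjmulAA1 maurerE /scale2 /=; congr Mat2; ring.
Qed.

Lemma adjmulA1W : adjmul A1 wronsk = scale2 r1 maurer.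
Proof.
by rewrite adjmul_wronsk adjmulA1A adjmulA1A1 maurerE /scale2 /=; congr Mat2; ring.
Qed.

(** det M = det(adj(A) A') - r r' tr(adj(A) A') + (r r')^2 = (r r')^2 - 2 (r
    r')^2 + (r r')^2. *)
Lemma maurer_nilpotent : m ^+ 2 + n * k = 0.
Proof.
have [h0 h1 h2] := jet.
transitivity (- det2 maurer); first by rewrite maurerE; move: m n k => *; rewrite /det2 /=; ring.
transitivity (- (det2 A * det2 A1 + (r * r1) ^+ 2
   - r * r1 * (m11 (adjmul A A1) + m22 (adjmul A A1)))).
  by rewrite /det2 /=; ring.
by rewrite h0 h1 h2; ring.
Qed.

(** det (r A' - r' A) is a combination of det A, det A' and tr (adj(A) A')
    that cancels. *)
Lemma adjmulWW : adjmul wronsk wronsk = Mat2 0 0 0 0.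
Proof.
have [h0 h1 h2] := jet.
suff d : det2 wronsk = 0.
  by move: d; rewrite /det2 /adjmul => d; congr Mat2;
    [rewrite -d; ring|ring|ring|rewrite -d; ring].
transitivity (r ^+ 2 * det2 A1 + r1 ^+ 2 * det2 A
   - r * r1 * (m11 (adjmul A A1) + m22 (adjmul A A1))).
  by rewrite /det2 /=; ring.
by rewrite h0 h1 h2; ring.
Qed.

Local Notation G := (gram maurer maurer).
Local Notation S := (cdot r r).
Local Notation N := (pauli A A).
Local Notation W := (pauli wronsk wronsk).

Let jetE := (@dot_pauli R, @adjmul_scalel R[i], @adjmul_scaler R[i], adjmulAA, adjmulA1A1,
  adjmulAA1, adjmulA1A, adjmulAW, adjmulA1W, adjmulWW).

Ltac expand_complex := rewrite ?maurerE /gram /scale2 /= /cdot;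
  generalize m n k; generalize r r1; move=> [? ?] [? ?] [? ?] [? ?] [? ?] /=.

(** The products below are named after their factors: pos is A A^H, vel its
    derivative in the direction x, lap its Laplacian up to a factor, and nrm
    the hermitian square of [wronsk]. Each is the product of the traces minus
    the Lorentz product. *)
Lemma dot_pos_pos : dot N N = gram A A ^+ 2 - 4 * S ^+ 2.
Proof. by rewrite !jetE; congr (_ * _ - _); expand_complex; ring. Qed.

Lemma dot_pos_vel x : dot N (pauli A (scale2 x A1)) =
  gram A A * gram A (scale2 x A1) - 4 * S * cdot r (x * r1).
Proof. by rewrite !jetE; congr (_ * _ - _); expand_complex; case: x => ? ? /=; ring. Qed.

Lemma dot_vel_vel x y : dot (pauli A (scale2 x A1)) (pauli A (scale2 y A1)) =
  gram A (scale2 x A1) * gram A (scale2 y A1)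
  - (4 * cdot r (x * r1) * cdot r (y * r1) - cdot x y * G).
Proof.
rewrite !jetE; congr (_ * _ - _); expand_complex; case: x => ? ?; case: y => ? ? /=; ring.
Qed.

Lemma dot_nrm_nrm : dot W W = gram wronsk wronsk ^+ 2.
Proof.
rewrite !jetE; rewrite [X in _ - X](_ : _ = 0) ?subr0 ?expr2//.
by rewrite /gram /cdot /=; ring.
Qed.

Lemma dot_pos_nrm : dot N W = gram A A * gram wronsk wronsk - 2 * S * G.
Proof. by rewrite !jetE; congr (_ * _ - _); expand_complex; ring. Qed.

Lemma dot_vel_nrm x : dot (pauli A (scale2 x A1)) W =
  gram A (scale2 x A1) * gram wronsk wronsk - 2 * cdot r (x * r1) * G.
Proof. by rewrite !jetE; congr (_ * _ - _); expand_complex; case: x => ? ? /=; ring. Qed.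

Lemma dot_lap_pos : dot (pauli A1 A1) N =
  gram A1 A1 * gram A A - (4 * S * cdot r1 r1 + 2 * G).
Proof. by rewrite !jetE; congr (_ * _ - _); expand_complex; ring. Qed.

Lemma dot_lap_nrm : dot (pauli A1 A1) W =
  gram A1 A1 * gram wronsk wronsk - 2 * cdot r1 r1 * G.
Proof. by rewrite !jetE; congr (_ * _ - _); expand_complex; ring. Qed.

End NullJet.

(** * First and second order geometry at a point *)

Section Frame.
Context {R : realType}.
Implicit Types (x y : R[i]).

Definition col2 x y : mat2 R[i] := Mat2 x 0 y 0.

Variables p1 p2 q1 q2 : R[i].

Let P := col2 p1 p2.
Let iP := col2 ('i%C * p1) ('i%C * p2).
Let Q := col2 q1 q2.
Let D := cdot (p1 * q2 - p2 * q1) (p1 * q2 - p2 * q1).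

(** When P and Q are columns, P Q^H + Q P^H, i (P Q^H - Q P^H) and P P^H - Q
    Q^H are three orthogonal directions of Minkowski space, whose orientation
    depends on neither P nor Q. This is the triple product of their space
    components. *)
Lemma frame_det3 :
  det3 (pauli P Q) (pauli iP Q) (pauli P P - pauli Q Q)
  = D * (gram P P + gram Q Q).
Proof.
rewrite /P /iP /Q /D /det3 /gram !mxE /= /cdot /cwedge.
case: p1 p2 q1 q2 => ? ? [? ?] [? ?] [? ?] /=.
ring.
Qed.

(** The four dimensional determinant of P P^H + Q Q^H, P Q^H + Q P^H, i (P Q^H
    - Q P^H) and P P^H, expanded along the time column. *)
Lemma frame_det4 :
  (gram P P + gram Q Q) * det3 (pauli P Q) (pauli iP Q) (pauli P P)
  - gram P P * det3 (pauli P Q) (pauli iP Q) (pauli P P + pauli Q Q)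
  - gram P Q * det3 (pauli P P + pauli Q Q) (pauli iP Q) (pauli P P)
  - gram iP Q * det3 (pauli P Q) (pauli P P + pauli Q Q) (pauli P P)
  = 2 * D ^+ 2.
Proof.
rewrite /P /iP /Q /D /det3 /gram !mxE /= /cdot /cwedge.
case: p1 p2 q1 q2 => ? ? [? ?] [? ?] [? ?] /=.
ring.
Qed.
End Frame.

Section PointGeometry.
Context {R : realType}.
Variables (A A1 : mat2 R[i]) (r r1 : R[i]).
Implicit Types x y : R[i].

(** The denominator 1 + x_0 of the projection from the hyperboloid to the
    ball, multiplied by 2 |r|^2. *)
Definition height : R := gram A A + 2 * cdot r r.
Definition ball_pt : 'rV[R]_3 := height^-1 *: pauli A A.
Definition dheight x : R := 2 * gram A (scale2 x A1) + 4 * cdot r (x * r1).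
(** The derivative of [ball_pt] in the direction x, by the quotient rule. *)
Definition dball x : 'rV[R]_3 :=
  height^-1 *: (2 *: pauli A (scale2 x A1) - dheight x *: ball_pt).
Definition lap_height : R := 4 * gram A1 A1 + 8 * cdot r1 r1.
(** The Laplacian of [ball_pt], from E Lap f = Lap (E f) - f Lap E - 2 grad E
    . grad f; second derivatives of [A] and [r] cancel. *)
Definition lap_ball : 'rV[R]_3 := height^-1 *: (4 *: pauli A1 A1
  - lap_height *: ball_pt
  - 2 *: (dheight 1 *: dball 1 + dheight 'i%C *: dball 'i%C)).

Local Notation M := (maurer A A1 r r1).
Local Notation L := (wronsk A A1 r r1).
Local Notation G := (gram M M).
Local Notation S := (cdot r r).

(** The Euclidean normal, of length [gram M M]. In the hyperboloid X + n is a
    positive multiple of the null vector L L^H; this is the image of n under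
    the differential of the projection to the ball. *)
Definition normal_pt : 'rV[R]_3 := pauli L L - (gram L L + G) *: ball_pt.

Hypothesis jet : null_jet A A1 r r1.
Hypothesis E0 : height != 0.

Let TE : gram A A = height - 2 * S.
Proof. by rewrite /height addrK. Qed.

Lemma dot_ball : dot ball_pt ball_pt = 1 - 4 * S / height.
Proof.
rewrite /ball_pt !dot_lin (dot_pos_pos jet) TE.
by field.
Qed.

Lemma dot_ball_pauli x : dot ball_pt (pauli A (scale2 x A1)) =
  gram A (scale2 x A1) - 2 * S / height * (gram A (scale2 x A1) + 2 * cdot r (x * r1)).
Proof.
rewrite /ball_pt !dot_lin (dot_pos_vel jet) TE.
by field.
Qed.

(** The induced metric is conformal, and its factor stays positive where r
    vanishes. *)
Lemma dot_dball x y :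
  dot (dball x) (dball y) = cdot x y * (4 * G / height ^+ 2).
Proof.
rewrite /dball; move: ball_pt dot_ball dot_ball_pauli => f ff fN.
by rewrite !dot_lin (dot_vel_vel jet) (dotC _ f) !fN ff /dheight; field.
Qed.

Lemma dot_ball_wronsk : dot ball_pt (pauli L L) =
  gram L L - 2 * S * (gram L L + G) / height.
Proof.
rewrite /ball_pt !dot_lin (dot_pos_nrm jet) TE.
by field.
Qed.

Lemma dot_ball_normal : dot ball_pt normal_pt =
  - G + 2 * S * (gram L L + G) / height.
Proof.
rewrite /normal_pt; move: ball_pt dot_ball dot_ball_wronsk => f ff fW.
by rewrite !dot_lin ff fW; field.
Qed.

Lemma dot_dball_normal x : dot (dball x) normal_pt = 0.
Proof.
rewrite /dball /normal_pt.
move: ball_pt dot_ball dot_ball_pauli dot_ball_wronsk => f ff fN fW.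
by rewrite !dot_lin (dot_vel_nrm jet) (dotC _ f) fN ff fW /dheight; field.
Qed.

Lemma dot_normal : dot normal_pt normal_pt = G ^+ 2.
Proof.
rewrite /normal_pt; move: ball_pt dot_ball dot_ball_wronsk => f ff fW.
by rewrite !dot_lin (dot_nrm_nrm jet) (dotC _ f) ff fW; field.
Qed.

(** Tangential derivatives drop out of the Laplacian, so only its products
    with the position and with the null vector L L^H remain. *)
Lemma dot_lap_normal : dot lap_ball normal_pt =
  8 * G * (gram L L + G) / height ^+ 2.
Proof.
have fv := dot_ball_normal; have dv := dot_dball_normal.
have lv : dot (pauli A1 A1) normal_pt = gram A1 A1 * gram L L - 2 * cdot r1 r1 * G
   - (gram L L + G) * (height^-1 * (gram A1 A1 * gram A A - (4 * S * cdot r1 r1 + 2 * G))).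
  by rewrite /normal_pt /ball_pt !dot_lin (dot_lap_nrm jet) (dot_lap_pos jet).
move: normal_pt fv dv lv => v fv dv lv; rewrite /lap_ball.
move: dball ball_pt dv fv => df f dv fv.
rewrite !dot_lin !dv fv lv TE /lap_height.
by field.
Qed.

End PointGeometry.

Section Orientation.
Context {R : realType}.
Implicit Types (x y p q : R[i]).

(** A nilpotent matrix is the product of a column (p1, p2) and the orthogonal
    row (p2, -p1), up to a factor. *)
Lemma nilpotent_rank1 (m n k : R[i]) : m ^+ 2 + n * k = 0 ->
  exists mu p1 p2 : R[i], [/\ 0 < cdot p1 p1 + cdot p2 p2, m = mu * p1 * p2,
    n = - (mu * p1 ^+ 2) & k = mu * p2 ^+ 2].
Proof.
move=> mnk; have [k0|k0] := eqVneq k 0.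
  have m0 : m = 0.
    by apply/eqP; move/eqP: mnk; rewrite k0 mulr0 addr0 sqrf_eq0.
  exists (- n), 1, 0; rewrite m0 k0; split; try ring.
  exact: ltr_pwDl (cdot_gt0 (oner_neq0 _)) (cdot_ge0 _).
exists (k^-1), m, k; split.
- exact: ltr_wpDl (cdot_ge0 _) (cdot_gt0 k0).
- by field.
- rewrite (_ : m ^+ 2 = - (n * k)); first by field.
  by apply/eqP; rewrite -addr_eq0; apply/eqP.
- by field.
Qed.

(** The triple product of three vectors v - t f, for f the projection of P P^H
    + Q Q^H, becomes after multiplication by E the four dimensional
    determinant of [frame_det4] plus delta times the triple product of
    [frame_det3]. *)
Lemma frame_orientation (p1 p2 q1 q2 : R[i]) (delta : R) :
  let P := col2 p1 p2 in
  let iP := col2 ('i%C * p1) ('i%C * p2) in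
  let Q := col2 q1 q2 in
  let E := gram P P + gram Q Q + 2 * delta in
  let f := E^-1 *: (pauli P P + pauli Q Q) in
  cdot (p1 * q2 - p2 * q1) (p1 * q2 - p2 * q1) = delta ^+ 2 -> E != 0 ->
  det3 (pauli P Q - gram P Q *: f) (pauli iP Q - gram iP Q *: f)
       (pauli P P - (gram P P + delta) *: f) = delta ^+ 3.
Proof.
move=> P iP Q E f hD E0.
have h3 := frame_det3 p1 p2 q1 q2; have h4 := frame_det4 p1 p2 q1 q2.
rewrite -/P -/iP -/Q hD in h3 h4.
apply: (mulfI E0).
transitivity (2 * delta ^+ 2 ^+ 2 + delta * (delta ^+ 2 * (gram P P + gram Q Q))).
  rewrite -h3 -h4.
  transitivity (E * det3 (pauli P Q) (pauli iP Q) (pauli P P)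
   - (gram P P + delta) * det3 (pauli P Q) (pauli iP Q) (pauli P P + pauli Q Q)
   - gram P Q * det3 (pauli P P + pauli Q Q) (pauli iP Q) (pauli P P)
   - gram iP Q * det3 (pauli P Q) (pauli P P + pauli Q Q) (pauli P P)).
    rewrite /f; move: (E) E0 => e e0.
    move: (pauli P Q) (pauli iP Q) (pauli P P) (pauli Q Q) => *.
    by rewrite /det3 !mxE; field.
  rewrite /E; move: (pauli P Q) (pauli iP Q) (pauli P P) (pauli Q Q) => *.
  by rewrite /det3 !mxE; ring.
by rewrite /E; ring.
Qed.

Section AdaptedFrame.
Variables (A : mat2 R[i]) (p1 p2 : R[i]).

(** The columns P = A p and Q = A q, with q the conjugate of (p2, -p1). They
    turn A A^H into P P^H + Q Q^H up to the factor |p|^2. For the vector p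
    that [nilpotent_rank1] attaches to [maurer], F' is a multiple of P times
    the row (p2, -p1), so that all tangent and normal data are expressed by P
    and Q. *)
Definition frame_P : mat2 R[i] :=
  col2 (m11 A * p1 + m12 A * p2) (m21 A * p1 + m22 A * p2).
Definition frame_iP : mat2 R[i] :=
  col2 ('i%C * (m11 A * p1 + m12 A * p2)) ('i%C * (m21 A * p1 + m22 A * p2)).
Definition frame_Q : mat2 R[i] :=
  col2 (m11 A * p2^*%C - m12 A * p1^*%C) (m21 A * p2^*%C - m22 A * p1^*%C).
(** The matrix x P (p2, -p1). *)
Definition rank1 x : mat2 R[i] :=
  Mat2 (x * m11 frame_P * p2) (- (x * m11 frame_P * p1))
       (x * m21 frame_P * p2) (- (x * m21 frame_P * p1)).

Local Notation P := frame_P.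
Local Notation iP := frame_iP.
Local Notation Q := frame_Q.
Local Notation g := (cdot p1 p1 + cdot p2 p2).

Ltac expand_frame := rewrite /frame_iP /rank1 /frame_P /frame_Q;
  case: A p1 p2 => [] [? ?] [? ?] [? ?] [? ?] [? ?] [? ?].

Ltac row_ring := apply/rowP; case; case=> [|[|[|//]]] ?;
  rewrite /pauli /cdot /cwedge !mxE /=; ring.

Lemma frame_det : cdot (m11 P * m21 Q - m21 P * m11 Q) (m11 P * m21 Q - m21 P * m11 Q)
  = cdot (det2 A) (det2 A) * g ^+ 2.
Proof.
rewrite (_ : m11 P * m21 Q - m21 P * m11 Q
    = - det2 A * (p1 * p1^*%C + p2 * p2^*%C)).
  rewrite /cdot; case: (det2 A) p1 p2 => ? ? [? ?] [? ?] /=; ring.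
by rewrite /det2 /=; ring.
Qed.

Lemma frame_pauli : g *: pauli A A = pauli P P + pauli Q Q.
Proof. expand_frame; row_ring. Qed.

Lemma frame_gram : g * gram A A = gram P P + gram Q Q.
Proof. expand_frame; rewrite /gram /cdot /=; ring. Qed.

Lemma rank1_gram x : gram (rank1 x) (rank1 x) = cdot x x * g * gram P P.
Proof.
rewrite /rank1 /frame_P /gram /=.
move: (m11 A * p1 + m12 A * p2) (m21 A * p1 + m22 A * p2) => [? ?] [? ?].
by case: x p1 p2 => ? ? [? ?] [? ?]; rewrite /cdot /=; ring.
Qed.

Lemma rank1_pauli x : pauli (rank1 x) (rank1 x) = (cdot x x * g) *: pauli P P.
Proof.
rewrite /rank1 /frame_P /=.
move: (m11 A * p1 + m12 A * p2) (m21 A * p1 + m22 A * p2) => [? ?] [? ?].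
case: x p1 p2 => ? ? [? ?] [? ?]; row_ring.
Qed.

Lemma col_pauli x : pauli (col2 (x * m11 P) (x * m21 P)) Q =
  complex.Re x *: pauli P Q + complex.Im x *: pauli iP Q.
Proof.
rewrite /frame_P /frame_iP /=.
move: (m11 A * p1 + m12 A * p2) (m21 A * p1 + m22 A * p2) => [? ?] [? ?].
move: Q => [[? ?] [? ?] [? ?] [? ?]]; case: x => ? ?; row_ring.
Qed.

Lemma col_gram x : gram (col2 (x * m11 P) (x * m21 P)) Q =
  complex.Re x * gram P Q + complex.Im x * gram iP Q.
Proof.
rewrite /frame_P /frame_iP /gram /=.
move: (m11 A * p1 + m12 A * p2) (m21 A * p1 + m22 A * p2) => [? ?] [? ?].
move: Q => [[? ?] [? ?] [? ?] [? ?]]; case: x => ? ?; rewrite /cdot /=; ring.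
Qed.

Lemma mixed_pauli x t : pauli A
   (Mat2 (m11 (rank1 x) + t * m11 A) (m12 (rank1 x) + t * m12 A)
         (m21 (rank1 x) + t * m21 A) (m22 (rank1 x) + t * m22 A)) =
  complex.Re x *: pauli P Q + complex.Im x *: pauli iP Q + complex.Re t *: pauli A A.
Proof.
rewrite -col_pauli /rank1 /frame_Q; move: (x * m11 P) (x * m21 P) => [? ?] [? ?].
case: t A p1 p2 => ? ? [] [? ?] [? ?] [? ?] [? ?] [? ?] [? ?]; row_ring.
Qed.

Lemma mixed_gram x t : gram A
   (Mat2 (m11 (rank1 x) + t * m11 A) (m12 (rank1 x) + t * m12 A)
         (m21 (rank1 x) + t * m21 A) (m22 (rank1 x) + t * m22 A)) =
  complex.Re x * gram P Q + complex.Im x * gram iP Q + complex.Re t * gram A A.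
Proof.
rewrite -col_gram /rank1 /frame_Q; move: (x * m11 P) (x * m21 P) => [? ?] [? ?].
case: t A p1 p2 => ? ? [] [? ?] [? ?] [? ?] [? ?] [? ?] [? ?].
by rewrite /gram /cdot /=; ring.
Qed.

End AdaptedFrame.

Variables (A A1 : mat2 R[i]) (r r1 : R[i]).
Hypothesis jet : null_jet A A1 r r1.
Hypothesis r0 : r != 0.
Hypothesis E0 : height A r != 0.

Local Notation M := (maurer A A1 r r1).
Local Notation L := (wronsk A A1 r r1).
Local Notation G := (gram M M).
Local Notation S := (cdot r r).

(** adj(A) W = r M, hence r^2 W = r A M. *)
Lemma wronsk_rank1 mu p1 p2 :
  M = Mat2 (mu * p1 * p2) (- (mu * p1 ^+ 2)) (mu * p2 ^+ 2) (- (mu * p1 * p2)) ->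
  L = rank1 A p1 p2 (mu / r).
Proof.
move=> ME; have [dA _ _] := jet.
have := adjmulK A L; rewrite dA (adjmulAW jet) ME.
move: L => [l1 l2 l3 l4]; rewrite /scale2 /= => -[e1 e2 e3 e4].
rewrite /rank1 /frame_P /=; congr Mat2; apply: (mulfI (expf_neq0 2 r0));
  by rewrite ?e1 ?e2 ?e3 ?e4; field.
Qed.

(** A' = W / r + (r' / r) A; the second term moves A A^H along itself only. *)
Lemma velocity_rank1 p1 p2 y x : L = rank1 A p1 p2 (r * y) ->
  scale2 x A1 =
   Mat2 (m11 (rank1 A p1 p2 (x * y)) + x * (r1 / r) * m11 A)
        (m12 (rank1 A p1 p2 (x * y)) + x * (r1 / r) * m12 A)
        (m21 (rank1 A p1 p2 (x * y)) + x * (r1 / r) * m21 A)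
        (m22 (rank1 A p1 p2 (x * y)) + x * (r1 / r) * m22 A).
Proof.
rewrite /wronsk /scale2 /rank1; case: (A1) => [a1 b1 c1 d1] /= [e1 e2 e3 e4].
have solve (l s v w : R[i]) : r * l - r1 * s = v -> v * x = r * w ->
    x * l = w + x * (r1 / r) * s.
  move=> ev ew; apply: (mulfI r0); rewrite mulrDr -ew -ev; by field.
by congr Mat2; [apply: (solve _ _ _ _ e1)|apply: (solve _ _ _ _ e2)
  |apply: (solve _ _ _ _ e3)|apply: (solve _ _ _ _ e4)]; ring.
Qed.

(** The sign of the triple product decides between mean curvature 1 and -1. It
    comes from [frame_orientation]: replacing the two tangent vectors by their
    expressions in P Q^H and i P Q^H multiplies the triple product by the
    squared norm of a complex number. *)
Lemma orientation :
  det3 (dball A A1 r r1 1) (dball A A1 r r1 'i%C) (normal_pt A A1 r r1)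
  = 4 * G ^+ 2 / height A r ^+ 2.
Proof.
have [mu [p1 [p2 [g0 hm hn hk]]]] := nilpotent_rank1 (maurer_nilpotent jet).
set g := cdot p1 p1 + cdot p2 p2 in g0.
set th := mu / r ^+ 2; set t := r1 / r.
have ME : M = Mat2 (mu * p1 * p2) (- (mu * p1 ^+ 2)) (mu * p2 ^+ 2) (- (mu * p1 * p2)).
  by rewrite (maurerE jet) hm hn hk.
have LE : L = rank1 A p1 p2 (r * th).
  by rewrite (wronsk_rank1 ME); congr (rank1 _ _ _ _); rewrite /th; field.
have A1E x := velocity_rank1 x LE; rewrite -/t in A1E.
have hS x : cdot r (x * r1) = complex.Re (x * t) * S.
  rewrite (_ : r1 = t * r); last by rewrite /t; field.
  by move: (r) (t) x => [? ?] [? ?] [? ?]; rewrite /cdot /=; ring.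
have hG : G = cdot th th * (S * g) ^+ 2.
  rewrite ME (_ : mu = r ^+ 2 * th); last by rewrite /th; field.
  rewrite /g; move: (r) (th) (p1) (p2) => [? ?] [? ?] [? ?] [? ?].
  by rewrite /gram /cdot /=; ring.
have hrth : cdot (r * th) (r * th) = S * cdot th th.
  by move: (r) (th) => [? ?] [? ?]; rewrite /cdot /=; ring.
have S0 : 0 < S := cdot_gt0 r0.
have hD := frame_det A p1 p2.
rewrite (_ : cdot (det2 A) (det2 A) * _ = (S * g) ^+ 2) in hD; last first.
  have [-> _ _] := jet; rewrite /g; move: (r) (cdot p1 p1) (cdot p2 p2) => [? ?] ? ?.
  by rewrite /cdot /=; ring.
have gE : g * height A r
    = gram (frame_P A p1 p2) (frame_P A p1 p2) + gram (frame_Q A p1 p2) (frame_Q A p1 p2)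
      + 2 * (S * g).
  by rewrite -frame_gram /height -/g; ring.
have gE0 : g * height A r != 0 by rewrite mulf_neq0// gt_eqF.
have fE : ball_pt A r = (g * height A r)^-1 *:
    (pauli (frame_P A p1 p2) (frame_P A p1 p2) + pauli (frame_Q A p1 p2) (frame_Q A p1 p2)).
  by rewrite -frame_pauli scalerA invfM mulrAC mulVf ?mul1r// gt_eqF.
have hF := frame_orientation hD.
rewrite -gE -fE in hF; have {}hF := hF gE0.
have NE : pauli A A = height A r *: ball_pt A r.
  by rewrite /ball_pt scalerA mulfV ?scale1r.
have dE x : dball A A1 r r1 x = (2 / height A r) *: (
     complex.Re (x * th) *: (pauli (frame_P A p1 p2) (frame_Q A p1 p2)
         - gram (frame_P A p1 p2) (frame_Q A p1 p2) *: ball_pt A r)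
   + complex.Im (x * th) *: (pauli (frame_iP A p1 p2) (frame_Q A p1 p2)
         - gram (frame_iP A p1 p2) (frame_Q A p1 p2) *: ball_pt A r)).
  have TE : gram A A = height A r - 2 * S by rewrite /height addrK.
  rewrite /dball /dheight A1E mixed_pauli mixed_gram hS NE TE.
  by apply/rowP => i; rewrite !mxE; field.
have nE : normal_pt A A1 r r1 = (cdot th th * (S * g)) *:
    (pauli (frame_P A p1 p2) (frame_P A p1 p2)
     - (gram (frame_P A p1 p2) (frame_P A p1 p2) + S * g) *: ball_pt A r).
  rewrite /normal_pt LE rank1_pauli rank1_gram hG hrth -/g.
  by apply/rowP => i; rewrite !mxE; ring.
rewrite !dE nE hG; clear -hF E0.
move: hF; set a := pauli _ _ - _; set b := pauli _ _ - _; set c := pauli _ _ - _ => hF.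
transitivity (4 / height A r ^+ 2 * cdot th th ^+ 2 * (S * g) * det3 a b c).
  clearbody a b c th g; rewrite mul1r; case: th => ? ?; rewrite /det3 !mxE /cdot /=.
  by field.
by rewrite hF; field.
Qed.

End Orientation.

(** * Mean curvature in the Poincare ball *)

Section PoincareBall.
Context {R : realType}.
Implicit Types x v w : 'rV[R]_3.

Lemma sqnorm_dot n (x : 'rV[R]_n) : sqnorm x = \sum_i x 0 i * x 0 i.
Proof. by apply: eq_bigr => i _; rewrite expr2. Qed.

Lemma sqnorm3 x : sqnorm x = dot x x.
Proof. by rewrite sqnorm_dot dotE. Qed.

Lemma inner_scalar (g : 'rV[R]_3 -> 'M[R]_3) c x v w : g x = c%:M ->
  inner g x v w = c * dot v w.
Proof.
move=> gx; rewrite /inner gx mul_mx_scalar -scalemxAl mxE mxE dotE.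
by congr (_ * _); apply: eq_bigr => i _; rewrite mxE.
Qed.

Lemma is_derive_inv (V : normedModType R) (h : V -> R) (x v : V) dh : h x != 0 ->
  is_derive x v h dh -> is_derive x v (fun y => (h y)^-1) (- dh / h x ^+ 2).
Proof.
move=> hx [dx <-]; split; first exact: derivableV.
by rewrite deriveV// /GRing.scale /= mulNr mulNr mulrC.
Qed.

Lemma is_derive_poincare x (i : 'I_3) : sqnorm x < 1 ->
  is_derive x ('e_i : 'rV[R]_3) (fun y : 'rV[R]_3 => 4 / (1 - sqnorm y) ^+ 2)
    (16 * x 0 i / (1 - sqnorm x) ^+ 3).
Proof.
move=> x1; have e0 : 1 - sqnorm x != 0 by rewrite subr_eq0 gt_eqF.
pose X j : 'rV[R]_3 -> R := fun y => y 0 j.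
have c j : is_derive x ('e_i : 'rV[R]_3) (X j) ((j == i)%:R) by exact: is_derive_coord.
have sX (y : 'rV[R]_3) : sqnorm y = X 0 y * X 0 y + X 1 y * X 1 y + X 2%:R y * X 2%:R y.
  by rewrite sqnorm3.
pose h : 'rV[R]_3 -> R := cst 1 - (X 0 * X 0 + X 1 * X 1 + X 2%:R * X 2%:R).
have d : is_derive x ('e_i : 'rV[R]_3) h (- (2 * x 0 i)).
  have dsq j := is_deriveM (c j) (c j).
  have dh := is_deriveB (is_derive_cst (1 : R) x ('e_i))
    (is_deriveD (is_deriveD (dsq 0) (dsq 1)) (dsq 2%:R)).
  apply: is_derive_eq dh _; rewrite /GRing.scale /= /X {c dsq}.
  by case: i => [[|[|[|//]]]] ?; rewrite /= -?val_eqE /=;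
    [rewrite (_ : Ordinal _ = 0)|rewrite (_ : Ordinal _ = 1)
    |rewrite (_ : Ordinal _ = 2%:R)]; rewrite ?mulr0 ?mulr1; try exact/val_inj; ring.
have hE y : h y = 1 - sqnorm y by rewrite sX.
have hx : h x != 0 by rewrite hE.
rewrite (_ : (fun y => _) = cst 4 * ((fun y => (h y)^-1) * (fun y => (h y)^-1))); last first.
  by apply/funext => y; rewrite /= -hE expr2 invfM.
have dV := is_derive_inv hx d.
apply: is_derive_eq (is_deriveM (is_derive_cst (4 : R) x ('e_i)) (is_deriveM dV dV)) _.
rewrite hE.
by rewrite /GRing.scale /=; field.
Qed.

(** For a metric mu times the identity the symbols only involve the
    logarithmic derivative of mu, which is 4 x_i / (1 - |x|^2). *)
Lemma christoffel_poincare x (k i j : 'I_3) : sqnorm x < 1 ->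
  christoffel (@poincare_metric R) x k i j = 2 / (1 - sqnorm x) *
    ((j == k)%:R * x 0 i + (i == k)%:R * x 0 j - (i == j)%:R * x 0 k).
Proof.
move=> x1; have e0 : 1 - sqnorm x != 0 by rewrite subr_eq0 gt_eqF.
pose mu' m := 16 * x 0 m / (1 - sqnorm x) ^+ 3.
have D (m p q : 'I_3) : 'D_('e_m) (fun y : 'rV[R]_3 => (@poincare_metric R) y p q) x
    = (p == q)%:R * mu' m.
  rewrite (_ : (fun y => _) = cst ((p == q)%:R : R) *
      (fun y : 'rV[R]_3 => 4 / (1 - sqnorm y) ^+ 2)); last first.
    apply/funext => y; rewrite /poincare_metric !mxE.
    by rewrite -[LHS]mulr_natl.
  have dp := is_derive_poincare m x1.
  have dm := is_deriveM (is_derive_cst ((p == q)%:R : R) x ('e_m)) dp.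
  rewrite (@derive_val _ _ _ _ _ _ _ dm).
  by rewrite /GRing.scale /= mulr0 addr0.
rewrite /christoffel /poincare_metric invmx_scalar.
under eq_bigr do rewrite !D mxE.
rewrite (bigD1 k) //= eqxx big1 ?addr0 => [|l /negbTE lk]; last first.
  by rewrite eq_sym lk mulr0n mul0r.
rewrite mulr1n /mu'; move: e0; move: (1 - sqnorm x) => s s0.
by field.
Qed.

Lemma sum3_delta (F : 'I_3 -> R) k : \sum_j (j == k)%:R * F j = F k.
Proof.
rewrite (bigD1 k) //= eqxx mul1r big1 ?addr0 // => j /negbTE ->.
by rewrite mul0r.
Qed.

Lemma covariant_poincare (f : 'rV[R]_2 -> 'rV[R]_3) u a b :
  sqnorm (f u) < 1 ->
  let X := 'D_('e_a) f u in let Y := 'D_('e_b) f u in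
  covariant (@poincare_metric R) f u a b = 'D_('e_a) ('D_('e_b) f) u
   + (2 / (1 - sqnorm (f u))) *:
     (dot (f u) X *: Y + dot (f u) Y *: X - dot X Y *: f u).
Proof.
move=> fu1 X Y; apply/rowP => k; rewrite [LHS]mxE [RHS]mxE; congr (_ + _).
under eq_bigr do under eq_bigr do rewrite christoffel_poincare// -/X -/Y.
clearbody X Y; move: (f u) => x; set q := 2 / _; rewrite !mxE !dotE.
transitivity (\sum_i \sum_j (q * x 0 i * X 0 i * ((j == k)%:R * Y 0 j)
   + q * ((i == k)%:R * X 0 i) * (x 0 j * Y 0 j)
   - q * x 0 k * X 0 i * ((i == j)%:R * Y 0 j))).
  by apply: eq_bigr => i _; apply: eq_bigr => j _; ring.
under eq_bigr do rewrite sumrB big_split /= -!mulr_sumr sum3_delta.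
under eq_bigr do under [X in _ - _ * X]eq_bigr do rewrite eq_sym.
under eq_bigr do rewrite sum3_delta.
rewrite sumrB big_split /=.
rewrite [X in X + _ - _](_ : _ = q * (\sum_i x 0 i * X 0 i) * Y 0 k); last first.
  by rewrite mulr_sumr mulr_suml; apply: eq_bigr => i _; ring.
rewrite [X in _ + X - _](_ : _ = q * X 0 k * (\sum_i x 0 i * Y 0 i)); last first.
  set D := \sum_i x 0 i * Y 0 i; rewrite -[RHS](sum3_delta (fun l => q * X 0 l * D)).
  by apply: eq_bigr => i _; ring.
rewrite [X in _ - X](_ : _ = q * x 0 k * \sum_i X 0 i * Y 0 i); last first.
  by rewrite mulr_sumr; apply: eq_bigr => i _; ring.
by ring.
Qed.

(** The formula for the mean curvature under a conformal change of the ambient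
    metric. It holds for normals N of any length, being linear in N. *)
Lemma mean_curvature_poincare (f : 'rV[R]_2 -> 'rV[R]_3) (N : 'rV[R]_3) u (c : R) :
  sqnorm (f u) < 1 -> 0 < c ->
  (forall a b, dot ('D_('e_a) f u) ('D_('e_b) f u) = (a == b)%:R * c) ->
  (forall a, dot ('D_('e_a) f u) N = 0) ->
  mean_curvature (@poincare_metric R) f N u =
    dot (\sum_(a < 2) 'D_('e_a) ('D_('e_a) f) u) N / (2 * c)
    - 2 * dot (f u) N / (1 - sqnorm (f u)).
Proof.
move=> fu1 c0 fab fN; have e0 : 1 - sqnorm (f u) != 0 by rewrite subr_eq0 gt_eqF.
have gE : (@poincare_metric R) (f u) = (4 / (1 - sqnorm (f u)) ^+ 2)%:M by [].
have IE : first_form (@poincare_metric R) f u = (4 / (1 - sqnorm (f u)) ^+ 2 * c)%:M.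
  apply/matrixP => a b; rewrite !mxE (inner_scalar _ _ gE) fab.
  by rewrite mulrCA -[RHS]mulr_natl.
have II a : second_form (@poincare_metric R) f N u a a =
    4 / (1 - sqnorm (f u)) ^+ 2 * (dot ('D_('e_a) ('D_('e_a) f) u) N
      - 2 / (1 - sqnorm (f u)) * c * dot (f u) N).
  rewrite mxE (inner_scalar _ _ gE) covariant_poincare//; congr (_ * _).
  move: (fN a) (fab a a); rewrite eqxx mul1r.
  move: ('D_('e_a) f u) ('D_('e_a) ('D_('e_a) f) u) => X Y XN XX.
  by rewrite !dot_lin XN XX; ring.
rewrite /mean_curvature IE invmx_scalar mul_scalar_mx mxtraceZ /mxtrace.
have [Y YE] : exists Y, forall a : 'I_2, 'D_('e_a) ('D_('e_a) f) u = Y a.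
  by exists (fun a => 'D_('e_a) ('D_('e_a) f) u).
under eq_bigr do rewrite II YE.
under [\sum_a 'D_('e_a) _ u]eq_bigr do rewrite YE.
rewrite !big_ord_recl !big_ord0 dotDl dotDl.
move: e0; move: (1 - sqnorm (f u)) => s s0.
rewrite (_ : dot 0 N = 0); last by rewrite -(scale0r N) dotZl mul0r.
by field; rewrite s0 gt_eqF.
Qed.

End PoincareBall.

(** * The surface of a null curve *)

Definition map2 T T' (f : T -> T') (A : mat2 T) : mat2 T' :=
  Mat2 (f (m11 A)) (f (m12 A)) (f (m21 A)) (f (m22 A)).

Section NullCurves.
Context {R : realType}.
Implicit Types (p q r : {poly R[i]}) (A B : mat2 {poly R[i]}) (a : 'I_2)
  (u : 'rV[R]_2) (z : R[i]).

Definition eval2 A z : mat2 R[i] := map2 (fun p => p.[z]) A.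
Definition deriv2 A : mat2 {poly R[i]} := map2 (@deriv _) A.
Definition pdir2 a A : mat2 {poly R[i]} := map2 (pdir a) A.

Lemma is_derive_cdot p q u a :
  is_derive u ('e_a : 'rV[R]_2) (fun v => cdot p.[to_complex v] q.[to_complex v])
    (cdot (pdir a p).[to_complex u] q.[to_complex u]
     + cdot p.[to_complex u] (pdir a q).[to_complex u]).
Proof.
have [pr pi] := is_derive_re_im_horner p u a.
have [qr qi] := is_derive_re_im_horner q u a.
apply: is_derive_eq (is_deriveD (is_deriveM pr qr) (is_deriveM pi qi)) _.
by rewrite /cdot /GRing.scale /=; ring.
Qed.

Lemma is_derive_cwedge p q u a :
  is_derive u ('e_a : 'rV[R]_2) (fun v => cwedge p.[to_complex v] q.[to_complex v])
    (cwedge (pdir a p).[to_complex u] q.[to_complex u]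
     + cwedge p.[to_complex u] (pdir a q).[to_complex u]).
Proof.
have [pr pi] := is_derive_re_im_horner p u a.
have [qr qi] := is_derive_re_im_horner q u a.
apply: is_derive_eq (is_deriveB (is_deriveM pi qr) (is_deriveM pr qi)) _.
by rewrite /cwedge /GRing.scale /=; ring.
Qed.

Lemma re_rationalN f : re_rational f -> re_rational (- f) (R:=R).
Proof.
move=> rf; rewrite (_ : - f = cst (-1) * f).
  by apply: re_rationalM => //; exact: re_rational_cst.
by apply/funext => u; rewrite [RHS]mulN1r.
Qed.

Lemma re_rational_cdot p q :
  re_rational (fun u => cdot p.[to_complex u] q.[to_complex u]).
Proof.
by apply: re_rationalD; apply: re_rationalM;
  (exact: re_rational_Re || exact: re_rational_Im).
Qed.

Lemma re_rational_cwedge p q :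
  re_rational (fun u => cwedge p.[to_complex u] q.[to_complex u]).
Proof.
apply: re_rationalD; last apply: re_rationalN; apply: re_rationalM;
  (exact: re_rational_Re || exact: re_rational_Im).
Qed.

Lemma is_derive_gram A B u a :
  is_derive u ('e_a : 'rV[R]_2)
    (fun v => gram (eval2 A (to_complex v)) (eval2 B (to_complex v)))
    (gram (eval2 (pdir2 a A) (to_complex u)) (eval2 B (to_complex u))
     + gram (eval2 A (to_complex u)) (eval2 (pdir2 a B) (to_complex u))).
Proof.
have d p q := is_derive_cdot p q u a.
apply: is_derive_eq (is_deriveD (is_deriveD (is_deriveD (d _ _) (d _ _)) (d _ _)) (d _ _)) _.
by rewrite /gram /=; ring.
Qed.

Lemma re_rational_gram A B :
  re_rational (fun u => gram (eval2 A (to_complex u)) (eval2 B (to_complex u))).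
Proof.
have C p q := re_rational_cdot p q.
exact: (re_rationalD (re_rationalD (re_rationalD (C _ _) (C _ _)) (C _ _)) (C _ _)).
Qed.

Lemma is_derive_congr (V : normedModType R) (f g : V -> R) (x v : V) df dg :
  is_derive x v g dg -> f =1 g -> dg = df -> is_derive x v f df.
Proof. by move=> dG /funext -> <-. Qed.

Lemma re_rational_congr (f g : 'rV[R]_2 -> R) :
  re_rational g -> f =1 g -> re_rational f.
Proof. by move=> rg /funext ->. Qed.

Lemma is_derive_pauli A B u a i :
  is_derive u ('e_a : 'rV[R]_2)
    (fun v => pauli (eval2 A (to_complex v)) (eval2 B (to_complex v)) 0 i)
    ((pauli (eval2 (pdir2 a A) (to_complex u)) (eval2 B (to_complex u))
     + pauli (eval2 A (to_complex u)) (eval2 (pdir2 a B) (to_complex u))) 0 i).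
Proof.
have d p q := is_derive_cdot p q u a.
have w p q := is_derive_cwedge p q u a.
case: i => [[|[|[|//]]]] li.
- apply: is_derive_congr (is_deriveD (is_deriveD (is_deriveD (d _ _) (d _ _)) (d _ _)) (d _ _)) _ _;
    [by move=> v; rewrite mxE|by rewrite !mxE /=; ring].
- apply: is_derive_congr (is_deriveD (is_deriveD (is_deriveD (w _ _) (w _ _)) (w _ _)) (w _ _)) _ _;
    [by move=> v; rewrite mxE|by rewrite !mxE /=; ring].
- apply: is_derive_congr (is_deriveB (is_deriveB (is_deriveD (d _ _) (d _ _)) (d _ _)) (d _ _)) _ _;
    [by move=> v; rewrite mxE|by rewrite !mxE /=; ring].
Qed.

Lemma re_rational_pauli A B i :
  re_rational (fun u => pauli (eval2 A (to_complex u)) (eval2 B (to_complex u)) 0 i).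
Proof.
have C p q := re_rational_cdot p q; have W p q := re_rational_cwedge p q.
case: i => [[|[|[|//]]]] li.
- apply: re_rational_congr (re_rationalD (re_rationalD (re_rationalD (C _ _) (C _ _)) (C _ _)) (C _ _)) _ => v.
  by rewrite mxE.
- apply: re_rational_congr (re_rationalD (re_rationalD (re_rationalD (W _ _) (W _ _)) (W _ _)) (W _ _)) _ => v.
  by rewrite mxE.
- apply: re_rational_congr (re_rationalD (re_rationalD (re_rationalD (C _ _) (C _ _))
    (re_rationalN (C _ _))) (re_rationalN (C _ _))) _ => v.
  by rewrite mxE.
Qed.

(** The quotient rule in a form that reuses the quotient itself, which is what
    makes it easy to iterate. *)
Lemma is_derive_quotient (V : normedModType R) (N E : V -> R) (x v : V) dN dE :
  E x != 0 -> is_derive x v N dN -> is_derive x v E dE ->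
  is_derive x v (fun y => (E y)^-1 * N y) ((E x)^-1 * (dN - dE * ((E x)^-1 * N x))).
Proof.
move=> Ex DN DE; apply: is_derive_eq (is_deriveM (is_derive_inv Ex DE) DN) _.
by rewrite /GRing.scale /=; field.
Qed.

Lemma is_derive_row n (f : 'rV[R]_2 -> 'rV[R]_n) u v (d : 'rV[R]_n) :
  (forall i, is_derive u v (fun w => f w 0 i) (d 0 i)) -> is_derive u v f d.
Proof.
move=> D; have df : derivable f u v.
  by apply/derivable_mxP => i j; rewrite ord1; have [] := D j.
split => //; apply/rowP => i; rewrite derive_mx// mxE.
by have [_ ->] := D i.
Qed.

Lemma gramC (B C : mat2 R[i]) : gram B C = gram C B.
Proof. by rewrite /gram /cdot; ring. Qed.

Lemma pauliC (B C : mat2 R[i]) : pauli B C = pauli C B.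
Proof.
by apply/rowP; case; case=> [|[|[|//]]] ?; rewrite !mxE /= /cdot /cwedge; ring.
Qed.

Lemma eval2_pdir2 a A z : eval2 (pdir2 a A) z = scale2 (unit_dir a) (eval2 (deriv2 A) z).
Proof. by rewrite /eval2 /pdir2 /map2 /scale2 /= /pdir !hornerZ. Qed.

Lemma horner_pdir a p z : (pdir a p).[z] = unit_dir a * p^`().[z].
Proof. by rewrite hornerZ. Qed.

End NullCurves.

Section Surface.
Context {R : realType}.
Variables (A : mat2 {poly R[i]}) (r : {poly R[i]}).
Implicit Types (a : 'I_2) (u : 'rV[R]_2) (z : R[i]).

(** The last two conditions say that the matrices [A] and [M] vanish nowhere.
    *)
Definition null_curve : Prop :=
  [/\ det2 A = r ^+ 2, det2 (deriv2 A) = r^`() ^+ 2,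
      forall z, gram (eval2 A z) (eval2 A z) != 0 &
      forall z, let M := maurer (eval2 A z) (eval2 (deriv2 A) z) r.[z] r^`().[z] in
        gram M M != 0].

Definition surface u : 'rV[R]_3 := ball_pt (eval2 A (to_complex u)) r.[to_complex u].

Hypothesis null : null_curve.

Let e u := eval2 A (to_complex u).
Let e' u := eval2 (deriv2 A) (to_complex u).
Let s u := r.[to_complex u].
Let s' u := r^`().[to_complex u].
Let E u := height (e u) (s u).
Let G u := gram (maurer (e u) (e' u) (s u) (s' u)) (maurer (e u) (e' u) (s u) (s' u)).

Lemma null_curve_jet u : null_jet (e u) (e' u) (s u) (s' u).
Proof.
have [h0 h1 _ _] := null; split.
- by move/(congr1 (horner^~ (to_complex u))): h0; rewrite /det2 !hornerE.
- by move/(congr1 (horner^~ (to_complex u))): h1; rewrite /det2 !hornerE.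
- move/(congr1 (fun p => p^`().[to_complex u])): h0.
  rewrite /det2 expr2 derivB !derivM !hornerE => h.
  transitivity (r^`().[to_complex u] * r.[to_complex u]
     + r.[to_complex u] * r^`().[to_complex u]); last by rewrite /s /s'; ring.
  by rewrite -h /=; ring.
Qed.

Lemma surface_height u : 0 < E u.
Proof.
have [_ _ /(_ (to_complex u)) h _] := null.
have g0 : 0 < gram (e u) (e u) by rewrite lt0r h gram_ge0.
exact: ltr_wpDr (mulr_ge0 (ler0n _ 2) (cdot_ge0 _)) g0.
Qed.

Lemma is_derive_height u a : is_derive u ('e_a : 'rV[R]_2) E
  (dheight (e u) (e' u) (s u) (s' u) (unit_dir a)).
Proof.
have dg := is_derive_gram A A u a; have ds := is_derive_cdot r r u a.
apply: is_derive_congr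
  (is_deriveD dg (is_deriveM (is_derive_cst (2 : R) u ('e_a)) ds)) _ _ => [v //|].
rewrite !eval2_pdir2 !horner_pdir /dheight -/(e u) -/(e' u) -/(s u) -/(s' u).
rewrite (gramC (scale2 _ _)) /cdot /GRing.scale /=; ring.
Qed.

Lemma is_derive_surface u a : is_derive u ('e_a : 'rV[R]_2) surface
  (dball (e u) (e' u) (s u) (s' u) (unit_dir a)).
Proof.
have E0 : E u != 0 by rewrite gt_eqF ?surface_height.
apply: is_derive_row => i.
have dp := is_derive_pauli A A u a i.
apply: is_derive_congr (is_derive_quotient E0 dp (is_derive_height u a)) _ _ => [v|].
  by rewrite /surface /ball_pt mxE.
rewrite eval2_pdir2 -/(e u) -/(e' u) /dball /ball_pt -/(E u).
by rewrite (pauliC (scale2 _ _)) !mxE; ring.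
Qed.

Let e'' u a := eval2 (pdir2 a (pdir2 a A)) (to_complex u).
Let s'' u a := (pdir a (pdir a r)).[to_complex u].

Lemma is_derive_dheight u a : is_derive u ('e_a : 'rV[R]_2)
  (fun v => dheight (e v) (e' v) (s v) (s' v) (unit_dir a))
  (2 * (gram (scale2 (unit_dir a) (e' u)) (scale2 (unit_dir a) (e' u))
        + gram (e u) (e'' u a))
   + 4 * (cdot (unit_dir a * s' u) (unit_dir a * s' u) + cdot (s u) (s'' u a))).
Proof.
have dg := is_derive_gram A (pdir2 a A) u a.
have ds := is_derive_cdot r (pdir a r) u a.
have c k := is_derive_cst (k : R) u ('e_a).
apply: is_derive_congr (is_deriveD (is_deriveM (c 2) dg) (is_deriveM (c 4) ds)) _ _ => [v|].
  by rewrite /dheight -horner_pdir -eval2_pdir2.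
by rewrite eval2_pdir2 horner_pdir /GRing.scale /=; ring.
Qed.

Lemma is_derive_dball u a : is_derive u ('e_a : 'rV[R]_2)
  (fun v => dball (e v) (e' v) (s v) (s' v) (unit_dir a))
  ((E u)^-1 *: (2 *: (pauli (scale2 (unit_dir a) (e' u)) (scale2 (unit_dir a) (e' u))
        + pauli (e u) (e'' u a))
   - (2 * (gram (scale2 (unit_dir a) (e' u)) (scale2 (unit_dir a) (e' u))
        + gram (e u) (e'' u a))
   + 4 * (cdot (unit_dir a * s' u) (unit_dir a * s' u) + cdot (s u) (s'' u a)))
      *: surface u
   - (2 * dheight (e u) (e' u) (s u) (s' u) (unit_dir a)) *:
       dball (e u) (e' u) (s u) (s' u) (unit_dir a))).
Proof.
have E0 : E u != 0 by rewrite gt_eqF ?surface_height.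
apply: is_derive_row => i.
have dp := is_derive_pauli A (pdir2 a A) u a i.
have df := is_derive_surface u a.
have dfi : is_derive u ('e_a : 'rV[R]_2) (fun v => surface v 0 i)
    (dball (e u) (e' u) (s u) (s' u) (unit_dir a) 0 i).
  have [/derivable_mxP dd <-] := df; split; first exact: dd.
  by rewrite derive_mx ?mxE//; apply/derivable_mxP.
have c k := is_derive_cst (k : R) u ('e_a).
have dn := is_deriveB (is_deriveM (c 2) dp) (is_deriveM (is_derive_dheight u a) dfi).
have dbE v : dball (e v) (e' v) (s v) (s' v) (unit_dir a) 0 i = (E v)^-1 *
    (2 * pauli (e v) (eval2 (pdir2 a A) (to_complex v)) 0 i
     - dheight (e v) (e' v) (s v) (s' v) (unit_dir a) * surface v 0 i).
  by rewrite eval2_pdir2 [LHS]mxE [X in _ * X]mxE [X in X + _]mxE [X in _ + X]mxE [X in _ - X]mxE.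
apply: is_derive_congr (is_derive_quotient E0 dn (is_derive_height u a)) _ _ => [v|].
  exact: dbE.
rewrite -[(E u)^-1 * _ in X in _ * (_ - X)]dbE [RHS]mxE; congr (_ * _).
rewrite eval2_pdir2 /GRing.scale /= mulr0 addr0 -/(e u) -/(e' u) -/(e'' u a).
move: (dball _ _ _ _ _) (surface u) (dheight _ _ _ _ _) => db f dh.
by rewrite !mxE; ring.
Qed.

(** In the sum of the two pure second derivatives the contributions of A'' and
    r'' have factors 1 and i^2 and cancel. *)
Lemma laplacian_surface u :
  \sum_(a < 2) 'D_('e_a) ('D_('e_a) surface) u = lap_ball (e u) (e' u) (s u) (s' u).
Proof.
have D a : 'D_('e_a) ('D_('e_a) surface) u =
    'D_('e_a) (fun v => dball (e v) (e' v) (s v) (s' v) (unit_dir a)) u.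
  congr ('D_('e_a) _ u); apply/funext => v.
  by have [_ ->] := is_derive_surface v a.
under eq_bigr => a _ do rewrite D (@derive_val _ _ _ _ _ _ _ (is_derive_dball u a)).
pose K := eval2 (deriv2 (deriv2 A)) (to_complex u).
have eE a : e'' u a = scale2 (unit_dir a ^+ 2) K.
  by rewrite /e'' /eval2 /pdir2 /map2 /scale2 /= /pdir !derivZ !hornerZ; congr Mat2; ring.
have sE a : s'' u a = unit_dir a ^+ 2 * r^`()^`().[to_complex u].
  by rewrite /s'' /pdir !derivZ !hornerZ; ring.
rewrite !big_ord_recl big_ord0 addr0.
have -> : unit_dir ord0 = 1 :> R[i] by [].
have -> : unit_dir (lift ord0 ord0) = 'i%C :> R[i] by [].
rewrite !eE !sE.
have -> : unit_dir ord0 = 1 :> R[i] by [].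
have -> : unit_dir (lift ord0 ord0) = 'i%C :> R[i] by [].
rewrite sqr_i expr1n.
have g1 x (B : mat2 R[i]) : cdot x x = 1 -> gram (scale2 x B) (scale2 x B) = gram B B.
  by move=> x1; rewrite gram_scale x1 mul1r.
have p1 x (B : mat2 R[i]) : cdot x x = 1 -> pauli (scale2 x B) (scale2 x B) = pauli B B.
  by move=> x1; rewrite pauli_scale x1 scale1r.
have c1 x y : cdot x x = 1 -> cdot (x * y) (x * y) = cdot y y :> R.
  move=> x1; transitivity (cdot x x * cdot y y); last by rewrite x1 mul1r.
  by rewrite /cdot Re_complexM Im_complexM; ring.
have i1 : cdot 'i 'i = 1 :> R by rewrite /cdot /=; ring.
have o1 : cdot 1 1 = 1 :> R by rewrite /cdot /=; ring.
have gN (B C : mat2 R[i]) : gram B (scale2 (-1) C) = - gram B (scale2 1 C).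
  by rewrite /gram /scale2 /= !mul1r !mulN1r /cdot !raddfN /=; ring.
have pN (B C : mat2 R[i]) : pauli B (scale2 (-1) C) = - pauli B (scale2 1 C).
  apply/rowP; case; case=> [|[|[|//]]] ?; rewrite !mxE /= !mul1r !mulN1r;
    by rewrite /cdot /cwedge !raddfN /=; ring.
have cN (x y : R[i]) : cdot x (-1 * y) = - cdot x (1 * y).
  by rewrite mulN1r mul1r /cdot !raddfN /=; ring.
rewrite gN pN cN !g1// !p1// !c1// /lap_ball /lap_height -/(E u) -/(surface u).
move: (dball _ _ _ _ _) (dball _ _ _ _ _) (dheight _ _ _ _ _) (dheight _ _ _ _ _).
move: (pauli (e' u) _) (pauli (e u) _) (surface u) => *.
by apply/rowP => i; rewrite !mxE; ring.
Qed.

Lemma cdot_unit_dir a b : cdot (unit_dir a) (unit_dir b) = (a == b)%:R :> R.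
Proof.
case: a => [[|[|//]]] la; case: b => [[|[|//]]] lb;
  by rewrite /unit_dir /cdot -!val_eqE /=; ring.
Qed.

Lemma dot_surface u a b : dot ('D_('e_a) surface u) ('D_('e_b) surface u) =
  (a == b)%:R * (4 * G u / E u ^+ 2).
Proof.
have E0 : E u != 0 by rewrite gt_eqF ?surface_height.
rewrite (@derive_val _ _ _ _ _ _ _ (is_derive_surface u a)).
rewrite (@derive_val _ _ _ _ _ _ _ (is_derive_surface u b)).
by rewrite (dot_dball (null_curve_jet u) E0) cdot_unit_dir.
Qed.

Lemma sqnorm_surface u : sqnorm (surface u) = 1 - 4 * cdot (s u) (s u) / E u.
Proof.
have E0 : E u != 0 by rewrite gt_eqF ?surface_height.
by rewrite sqnorm3 (dot_ball (null_curve_jet u) E0).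
Qed.

Lemma smooth_surface (U : set 'rV[R]_2) : smooth U surface.
Proof.
apply: smooth_re_rational => i.
have rE : re_rational E.
  have C (k : R) : re_rational (cst k) := re_rational_cst k.
  have H := re_rationalD (re_rational_gram A A)
    (re_rationalM (C 2) (re_rational_cdot r r)).
  exact: (re_rational_congr H).
have rV : re_rational (fun u => (E u)^-1).
  by apply: re_rationalV => // u; rewrite gt_eqF ?surface_height.
by apply: re_rational_congr (re_rationalM rV (re_rational_pauli A A i)) _ => u; rewrite mxE.
Qed.

Lemma maurer_gt0 u : 0 < G u.
Proof.
have [_ _ _ /(_ (to_complex u)) h] := null.
by rewrite lt0r gram_ge0 andbT; exact: h.
Qed.

Lemma conformal_surface U : conformal_immersion (@euclidean_metric R) U surface.
Proof.
split=> [|u _]; first exact: smooth_surface.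
have E0 := surface_height u; have G0 := maurer_gt0 u.
exists (4 * G u / E u ^+ 2); first by rewrite divr_gt0 ?exprn_gt0 ?mulr_gt0.
apply/matrixP => a b; rewrite mxE [RHS]mxE (inner_scalar _ _ (c := 1)) ?dot_surface//.
by rewrite mul1r -[RHS]mulr_natl.
Qed.

(** The unit normal of the hyperbolic metric is the Euclidean one multiplied
    by (1 - |f|^2) / 2. *)
Theorem bryant_surface (U : set 'rV[R]_2) :
  (forall u, U u -> r.[to_complex u] != 0) -> bryant U surface.
Proof.
move=> rU.
have S0 u : U u -> 0 < cdot (s u) (s u) by move=> /rU; exact: cdot_gt0.
have E0 := surface_height; have G0 := maurer_gt0.
have f1 u : U u -> sqnorm (surface u) < 1.
  move=> Uu; rewrite sqnorm_surface ltrBlDr ltrDl.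
  by rewrite divr_gt0 ?mulr_gt0 ?S0.
have gE u : poincare_metric (surface u) = (4 / (1 - sqnorm (surface u)) ^+ 2)%:M by [].
split => //.
  split=> [|u Uu]; first exact: smooth_surface.
  exists (4 / (1 - sqnorm (surface u)) ^+ 2 * (4 * G u / E u ^+ 2)).
    by rewrite mulr_gt0 ?divr_gt0 ?exprn_gt0 ?mulr_gt0 ?subr_gt0 ?f1.
  apply/matrixP => a b; rewrite mxE [RHS]mxE (inner_scalar _ _ (gE u)) dot_surface.
  by rewrite mulrCA -[RHS]mulr_natl.
move=> u Uu; have jet := null_curve_jet u.
have nE0 : E u != 0 by rewrite gt_eqF.
have nG0 : G u != 0 by rewrite gt_eqF.
have nS0 : cdot (s u) (s u) != 0 by rewrite gt_eqF ?S0.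
have fE : 1 - sqnorm (surface u) = 4 * cdot (s u) (s u) / E u.
  by rewrite sqnorm_surface; ring.
pose v := normal_pt (e u) (e' u) (s u) (s' u).
have dE a := @derive_val _ _ _ _ _ _ _ (is_derive_surface u a).
have dv a : dot ('D_('e_a) surface u) v = 0 by rewrite dE (dot_dball_normal jet).
have vv : dot v v = G u ^+ 2 := dot_normal jet nE0.
have lv := dot_lap_normal jet nE0; have fv := dot_ball_normal jet nE0.
have ov := orientation jet (rU u Uu) nE0.
rewrite -/v in lv fv ov; clearbody v.
pose k := (1 - sqnorm (surface u)) / (2 * G u).
have k0 : 0 < k by rewrite divr_gt0 ?mulr_gt0 ?subr_gt0 ?f1.
exists (k *: v).
  split.
  - rewrite (inner_scalar _ _ (gE u)) !dot_lin vv /k fE.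
    by field; rewrite nE0 nG0 nS0.
  - by move=> a; rewrite (inner_scalar _ _ (gE u)) dotZr dv !mulr0.
  - rewrite det_col_mx3 !dE.
    have -> : unit_dir 0 = 1 :> R[i] by [].
    have -> : unit_dir 1 = 'i%C :> R[i] by [].
    have det3Z (x y z : 'rV[R]_3) : det3 x y (k *: z) = k * det3 x y z.
      by rewrite /det3 !mxE; ring.
    rewrite det3Z ov mulr_gt0//.
    apply: divr_gt0; last exact: (exprn_gt0 2 (E0 u)).
    by apply: mulr_gt0; [exact: ltr0Sn|exact: (exprn_gt0 2 (G0 u))].
rewrite (mean_curvature_poincare (c := 4 * G u / E u ^+ 2)) ?f1//.
- rewrite laplacian_surface !dotZr lv fv.
  rewrite -/(E u) -/(G u) /k fE; move: nE0 nG0 nS0.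
  by move: (E u) (G u) (cdot _ _) (gram _ _) => E' G' S' l e1 e2 e3; field; rewrite e1 e2 e3.
- by rewrite divr_gt0 ?exprn_gt0 ?mulr_gt0.
- exact: dot_surface.
- by move=> a; rewrite dotZr dv mulr0.
Qed.

End Surface.

(** * Spheres glued from two charts *)

Section Spheres.
Context {R : realType}.
Implicit Types (A : mat2 {poly R[i]}) (r : {poly R[i]}) (z w : R[i]) (b : bool).

(** The squared distances from z to the other roots have a positive lower
    bound d <= 1; since d^2 <= d, the number d serves as a radius. *)
Lemma root_isolated r z : r != 0 ->
  exists2 rho : R, 0 < rho &
    forall w, w != z -> cdot (w - z) (w - z) < rho ^+ 2 -> ~~ root r w.
Proof.
move=> r0.
suff [d /andP[d0 d1] dr] : exists2 d : R, 0 < d <= 1 &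
    forall w, w != z -> root r w -> d <= cdot (w - z) (w - z).
  exists d => // w wz wd; apply/negP => /(dr w wz) /le_lt_trans /(_ wd).
  by rewrite expr2 -[X in X < _]mulr1 ltr_pM2l // ltNge d1.
have [rs rE] := closed_field_poly_normal r.
have rsP w : root r w -> w \in rs.
  by rewrite rE rootZ ?lead_coef_eq0// root_prod_XsubC.
suff [d d01 dr] : exists2 d : R, 0 < d <= 1 &
    forall w, w \in rs -> w != z -> d <= cdot (w - z) (w - z).
  by exists d => // w wz /rsP wrs; exact: dr.
elim: rs {rE rsP} => [|x rs [d /andP[d0 d1] dr]]; first by exists 1; rewrite ?ltr01 ?lexx.
have [->|xz] := eqVneq x z.
  exists d; first by rewrite d0 d1.
  move=> w; rewrite inE => /predU1P[->|]; first by rewrite eqxx.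
  exact: dr.
have c0 : 0 < cdot (x - z) (x - z) by apply: cdot_gt0; rewrite subr_eq0.
exists (Num.min d (cdot (x - z) (x - z))).
  by rewrite lt_min d0 c0 ge_min d1.
move=> w; rewrite inE ge_min => /predU1P[-> _|wrs wz]; first by rewrite lexx orbT.
by rewrite dr.
Qed.

Definition zoom (z : R[i]) (rho : R) : {poly R[i]} := z%:P + (rho%:C)%C *: 'X.

Lemma eval2_comp A q z : eval2 (map2 (comp_poly q) A) z = eval2 A q.[z].
Proof. by rewrite /eval2 /map2 /= !horner_comp. Qed.

(** An affine change of the parameter with slope rho multiplies A', r' and M
    by rho, so it preserves all four conditions. *)
Lemma null_curve_zoom A r z rho : 0 < rho ->
  null_curve A r -> null_curve (map2 (comp_poly (zoom z rho)) A) (r \Po zoom z rho).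
Proof.
move=> rho0 [h0 h1 h2 h3]; set q := zoom z rho.
have dq : q^`() = ((rho%:C)%C)%:P.
  by rewrite /q derivD derivC derivZ derivX add0r alg_polyC.
have c0 : (rho%:C)%C != 0 :> R[i] by rewrite eq_complex /= eqxx andbT gt_eqF.
have E1 x : eval2 (deriv2 (map2 (comp_poly q) A)) x =
    scale2 (rho%:C)%C (eval2 (deriv2 A) q.[x]).
  by rewrite /eval2 /map2 /scale2 /= !deriv_comp dq !hornerM hornerC !horner_comp;
    congr Mat2; rewrite mulrC.
split.
- transitivity (det2 A \Po q); last by rewrite h0 rmorphXn.
  by rewrite /det2 /= rmorphB !rmorphM.
- have h1q : det2 (deriv2 A) \Po q = (r^`() \Po q) ^+ 2 by rewrite h1 rmorphXn.
  rewrite deriv_comp dq exprMn -h1q.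
  by rewrite /det2 /= !deriv_comp dq rmorphB !rmorphM /=; ring.
- by move=> x; rewrite eval2_comp.
- move=> x; cbv zeta; rewrite eval2_comp E1 horner_comp deriv_comp dq hornerM hornerC.
  rewrite horner_comp.
  rewrite (_ : maurer _ _ _ _ = scale2 (rho%:C)%C
     (maurer (eval2 A q.[x]) (eval2 (deriv2 A) q.[x]) r.[q.[x]] r^`().[q.[x]])).
    by rewrite gram_scale mulf_neq0// gt_eqF// cdot_gt0.
  by rewrite /maurer /scale2 /=; congr Mat2; ring.
Qed.

Lemma ball_pt_scale (k s : R[i]) (B : mat2 R[i]) : k != 0 ->
  ball_pt (scale2 k B) (k * s) = ball_pt B s.
Proof.
move=> k0; have c0 := cdot_gt0 k0.
rewrite /ball_pt pauli_scale scalerA; congr (_ *: _).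
rewrite /height gram_scale.
have -> : cdot (k * s) (k * s) = cdot k k * cdot s s.
  by rewrite /cdot; case: k s {k0 c0} => ? ? [? ?] /=; ring.
rewrite mulrCA -mulrDr invfM mulrAC mulVf ?mul1r// gt_eqF//.
Qed.

Lemma to_complex_zoom (a u : 'rV[R]_2) rho :
  to_complex (a + rho *: u) = (zoom (to_complex a) rho).[to_complex u].
Proof.
rewrite /zoom hornerD hornerC hornerZ hornerX /to_complex !mxE.
by apply/eqP; rewrite eq_complex /=; apply/andP; split; apply/eqP; ring.
Qed.

(** The data [A false], [r false] live in the chart z and [A true], [r true]
    in the chart 1/z. Both surfaces extend over the ends, so the composite
    with a chart is everywhere the surface of a null curve, and so is the
    composite with a disc around an end. *)
Theorem sphere_of_null_curves (A : bool -> mat2 {poly R[i]}) (r : bool -> {poly R[i]})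
    (lam : R[i] -> R[i]) (S : {fset CP1 R}) :
  (forall b, null_curve (A b) (r b)) -> (forall b, r b != 0) ->
  (forall z, z != 0 -> [/\ lam z != 0,
     eval2 (A true) z = scale2 (lam z) (eval2 (A false) z^-1) &
     (r true).[z] = lam z * (r false).[z^-1]]) ->
  (forall z, (Some z \in S) = root (r false) z) ->
  (None \in S) = root (r true) 0 ->
  exists f, bryant_sphere_smooth_ends S f.
Proof.
move=> nul r0 glue S0 S1.
have SE b z : (param b z \in S) = root (r b) z.
  case: b => /=; last exact: S0.
  case: eqVneq => [->//|z0]; have [l0 _ e] := glue z z0.
  by rewrite S0 !rootE e mulf_eq0 (negbTE l0).
pose f (p : CP1 R) := if p is Some z then ball_pt (eval2 (A false) z) (r false).[z]
  else ball_pt (eval2 (A true) 0) (r true).[0].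
have fE b z : f (param b z) = ball_pt (eval2 (A b) z) (r b).[z].
  case: b => //=; case: eqVneq => [->//|z0] /=; have [l0 -> ->] := glue z z0.
  by rewrite ball_pt_scale.
exists f; split.
  move=> b; rewrite (_ : (fun u => _) = surface (A b) (r b)).
    by apply: bryant_surface => // u /=; rewrite SE.
  by apply/funext => u; rewrite fE.
move=> p pS.
have [b [z pE]] : exists b z, param b z = p :> CP1 R.
  by case: p {pS} => [z|]; [exists false, z|exists true, 0; rewrite /= eqxx].
have [rho rho0 rhoP] := root_isolated z (r0 b).
pose a : 'rV[R]_2 := \row_i nth 0 [:: complex.Re z; complex.Im z] i.
have az : to_complex a = z by rewrite /to_complex !mxE /=; case: (z).
have away u : punctured_disc u -> ~~ root (r b) (zoom z rho).[to_complex u].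
  move=> [u1 /eqP u0]; apply: rhoP.
    rewrite /zoom hornerD hornerC hornerZ hornerX addrC -subr_eq0 addrK.
    rewrite mulf_neq0//; first by rewrite eq_complex /= eqxx andbT gt_eqF.
    apply: contraNN u0 => /eqP[u00 u01]; apply/eqP/rowP => -[[|[|//]]] j.
      by rewrite mxE -u00; congr (u 0 _); apply/val_inj.
    by rewrite mxE -u01; congr (u 0 _); apply/val_inj.
  rewrite (_ : cdot _ _ = rho ^+ 2 * sqnorm u); last first.
    rewrite /zoom hornerD hornerC hornerZ hornerX addrC addKr.
    have -> : sqnorm u = u 0 0 ^+ 2 + u 0 1 ^+ 2.
      by rewrite /sqnorm big_ord_recl big_ord1; congr (_ + u 0 _ ^+ 2); apply/val_inj.
    by rewrite /cdot /=; ring.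
  by rewrite -[X in _ < X]mulr1 ltr_pM2l ?exprn_gt0.
have nulz := null_curve_zoom z rho0 (nul b).
pose A' := map2 (comp_poly (zoom z rho)) (A b); pose r' := r b \Po zoom z rho.
have eE : (fun u => f (param b (to_complex (a + rho *: u)))) = surface A' r'.
  apply/funext => u; rewrite fE to_complex_zoom az.
  by rewrite /surface eval2_comp horner_comp.
exists b, a, rho; rewrite az eE; split => //.
  by move=> u /away; rewrite SE to_complex_zoom az.
split.
  apply: bryant_surface => // u /away.
  by rewrite rootE horner_comp.
have c0 : to_complex (0 : 'rV[R]_2) = 0.
  by apply/eqP; rewrite eq_complex /= !mxE eqxx.
exists (surface A' r' 0).
  rewrite sqnorm_surface// c0 /r' horner_comp /zoom !hornerE.
  have /eqP -> : root (r b) z by rewrite -SE pE.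
  by rewrite /cdot /= !mulr0 addr0 mulr0 mul0r subr0.
rewrite (_ : (fun u => _) = surface A' r'); first exact: conformal_surface.
by apply/funext => u; case: eqP => [->|].
Qed.

End Spheres.

(** * Horosphere and binomial null curves *)

Section Examples.
Context {R : realType}.
Implicit Types (A : mat2 {poly R[i]}) (r : {poly R[i]}) (z w : R[i]) (b : bool).

(** The case s = 1, k = 0; the second chart is multiplied by 1/z. *)
Definition horosphere_matrix (b : bool) : mat2 {poly R[i]} :=
  if b then Mat2 1 (- 'X) 'X 0 else Mat2 'X (-1) 1 0.

Lemma null_curve_horosphere_matrix b : null_curve (horosphere_matrix b) (if b then 'X else 1).
Proof.
case: b; split.
- by rewrite /det2 /=; ring.
- by rewrite /det2 /= derivN !derivX ?poly.derivE; ring.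
- by move=> z; apply/eqP => /gram_eq0[/= /eqP]; rewrite hornerC oner_eq0.
- move=> z; apply/eqP => /gram_eq0[_ _ /= /eqP].
  by rewrite ?poly.derivE !hornerE subr0 oner_eq0.
- by rewrite /det2 /=; ring.
- by rewrite /det2 /= derivX ?poly.derivE; ring.
- by move=> z; apply/eqP => /gram_eq0[_ _ /= /eqP]; rewrite hornerC oner_eq0.
- move=> z; apply/eqP => /gram_eq0[_ _ /= /eqP].
  by rewrite ?poly.derivE !hornerE oppr_eq0 oner_eq0.
Qed.

Variables (k : nat) (eps kap : R[i]).

(** The case s = z^n - eps and k = kap z^(2n-1), with n = k + 2. The equation
    k' = s'^2 requires kap (2n-1) = n^2. In the chart 1/z the data are
    multiplied by the power 2n of the new coordinate, which clears the
    denominators. *)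
Definition binomial_matrix (b : bool) : mat2 {poly R[i]} :=
  if b then Mat2 'X^(k.*2.+3)
     ((kap - 1)%:P + (2 * eps) *: 'X^(k.+2) - (eps ^+ 2) *: 'X^(k.+2.*2))
     'X^(k.+2.*2) (kap *: 'X)
  else Mat2 'X ((kap - 1) *: 'X^(k.+2.*2) + (2 * eps) *: 'X^(k.+2) - (eps ^+ 2)%:P)
     1 (kap *: 'X^(k.*2.+3)).

Definition binomial_root (b : bool) : {poly R[i]} :=
  if b then 'X^(k.+2) - eps *: 'X^(k.+2.*2) else 'X^(k.+2) - eps%:P.

Hypothesis kapE : kap * k.*2.+3%:R = k.+2%:R ^+ 2.

(** At the point at infinity [A] reduces to its entry kap - 1 and [M] to its
    entry - kap (kap - 1). Both are nonzero since n^2 differs from 2n - 1 for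
    n >= 2; for n = 1 the surface would be a horosphere that is regular at
    infinity. *)
Lemma null_curve_binomial_matrix b : null_curve (binomial_matrix b) (binomial_root b).
Proof.
pose Z : {poly R[i]} := 'X^k.
have e2 : 'X^(k.+2) = 'X ^+ 2 * Z by rewrite /Z -exprD.
have e3 : 'X^(k.*2.+3) = 'X ^+ 3 * Z ^+ 2.
  by rewrite /Z -exprM muln2 -exprD.
have e4 : 'X^(k.+2.*2) = 'X ^+ 4 * Z ^+ 2.
  by rewrite /Z -exprM muln2 -exprD; congr 'X^_; rewrite !doubleS.
have d2 : ('X^(k.+2))^`() = k.+2%:R *: ('X * Z) :> {poly R[i]}.
  by rewrite derivXn -scaler_nat /Z -exprS.
have d3 : ('X^(k.*2.+3))^`() = k.*2.+3%:R *: ('X ^+ 2 * Z ^+ 2) :> {poly R[i]}.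
  by rewrite derivXn -scaler_nat /Z -exprM muln2 -exprD.
have d4 : ('X^(k.+2.*2))^`() = (2 * k.+2%:R) *: ('X ^+ 3 * Z ^+ 2) :> {poly R[i]}.
  rewrite derivXn -scaler_nat -[in LHS]mul2n natrM; congr (_ *: _).
  by rewrite /Z -exprM muln2 -exprD mul2n !doubleS.
have [c cE] : exists c : R[i] -> {poly R[i]}, forall x, x%:P = c x by exists polyC.
have cB x y : c (x - y) = c x - c y by rewrite -!cE polyCB.
have cM x y : c (x * y) = c x * c y by rewrite -!cE polyCM.
have cX x : c (x ^+ 2) = c x ^+ 2 by rewrite -!cE -rmorphXn.
have c1 : c 1 = 1 by rewrite -cE.
have c2 : c 2 = 2 by rewrite -cE rmorph_nat.
have ck : c k.*2.+3%:R + 1 = 2 * c k.+2%:R.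
  by rewrite -!cE !rmorph_nat natr1 -natrM mul2n !doubleS.
have cn : c kap * c k.*2.+3%:R = c k.+2%:R ^+ 2 by rewrite -cM kapE cX.
have polyE := (e2, e3, e4, cE, cB, cM, cX, c1, c2).
have dE := (derivB, derivD, derivN, derivZ, derivC, d2, d3, d4, derivX).
have kap0 : kap != 0.
  apply: contra_eq_neq kapE => ->; rewrite mul0r eq_sym.
  by rewrite expf_neq0// pnatr_eq0.
(* n^2 = 2n - 1 only for n = 1. *)
have kap1 : kap != 1.
  apply: contra_eq_neq kapE => ->; rewrite mul1r -natrX eqr_nat.
  by rewrite neq_ltn -addnn; apply/orP; left; nia.
have b0 : (m12 (binomial_matrix true)).[0] = kap - 1.
  rewrite [LHS]hornerD hornerN hornerD hornerC !hornerZ !hornerXn doubleS !exprS.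
  by rewrite !mul0r !mulr0 addr0 subr0.
case: b; split.
- rewrite /det2 /= -!mul_polyC !polyE.
  by ring.
- rewrite /det2 /= !dE -!mul_polyC !polyE.
  apply: subr0_eq.
  transitivity ((c kap * c k.*2.+3%:R - c k.+2%:R ^+ 2) * ('X ^+ 2 * Z ^+ 2)); first by ring.
  by rewrite cn subrr mul0r.
- move=> z; apply/eqP => /gram_eq0[e11 e12 _ _].
  have z0 : z = 0.
    have : ('X^(k.*2.+3)).[z] = 0 := e11.
    by rewrite hornerXn => /eqP; rewrite expf_eq0 /= => /eqP.
  have : (m12 (binomial_matrix true)).[z] = 0 := e12.
  by rewrite z0 b0 => /eqP; rewrite subr_eq0 (negbTE kap1).
- move=> z; cbv zeta; apply/eqP => /gram_eq0[_ e12 e21 _].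
  (* The (2,1) entry of M is the power 4n - 2 of the coordinate. *)
  have p21 : ('X^(k.*2.+3) * ('X^(k.+2.*2))^`() - 'X^(k.+2.*2) * ('X^(k.*2.+3))^`()
      : {poly R[i]}) = 'X ^+ 6 * Z ^+ 4.
    rewrite !dE -!mul_polyC !polyE.
    transitivity ((2 * c k.+2%:R - c k.*2.+3%:R) * ('X ^+ 6 * Z ^+ 4)); first by ring.
    by rewrite -ck addrC addKr mul1r.
  have z0 : z = 0.
    have : ('X ^+ 6 * Z ^+ 4).[z] = 0.
      by rewrite -p21 hornerD hornerN hornerM [X in _ - X]hornerM; exact: e21.
    rewrite /Z -exprM -exprD hornerXn => /eqP; rewrite expf_eq0 => /andP[_].
    exact: eqP.
  have : (kap *: 'X).[z] * (m12 (deriv2 (binomial_matrix true))).[z]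
       - (m12 (binomial_matrix true)).[z] * (kap *: 'X)^`().[z] = 0 := e12.
  rewrite z0 b0 derivZ derivX !hornerZ hornerX hornerC mulr0 mul0r mulr1 sub0r => /eqP.
  by rewrite oppr_eq0 mulf_eq0 subr_eq0 (negbTE kap1) (negbTE kap0).
- rewrite /det2 /= -!mul_polyC !polyE.
  by ring.
- rewrite /det2 /= !dE -!mul_polyC !polyE.
  apply: subr0_eq.
  transitivity ((c kap * c k.*2.+3%:R - c k.+2%:R ^+ 2) * ('X ^+ 2 * Z ^+ 2)); first by ring.
  by rewrite cn subrr mul0r.
- by move=> z; apply/eqP => /gram_eq0[_ _ /= /eqP]; rewrite hornerC oner_eq0.
- move=> z; cbv zeta; apply/eqP => /gram_eq0[_ _ /= /eqP].
  rewrite derivX (derivC 1) horner0 !(hornerC 1) mulr0 sub0r mulr1.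
  by rewrite oppr_eq0 oner_eq0.
Qed.

Lemma binomial_root_neq0 b : binomial_root b != 0.
Proof.
have lead (p : {poly R[i]}) n : p`_n = 1 -> p != 0.
  by move=> h; apply: contra_eq_neq h => ->; rewrite coef0 eq_sym oner_eq0.
case: b; apply: (lead _ k.+2); rewrite /binomial_root ?coefB ?coefZ ?coefC coefXn eqxx.
  by rewrite coefXn (_ : (k.+2 == k.+2.*2) = false) ?mulr0 ?subr0// -addnn; lia.
by rewrite subr0.
Qed.

Lemma binomial_matrix_glue z : z != 0 ->
  [/\ z ^+ k.+2.*2 != 0,
     eval2 (binomial_matrix true) z = scale2 (z ^+ k.+2.*2) (eval2 (binomial_matrix false) z^-1) &
     (binomial_root true).[z] = z ^+ k.+2.*2 * (binomial_root false).[z^-1]].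
Proof.
move=> z0.
have e3 : z ^+ k.*2.+3 = z ^+ 3 * (z ^+ k) ^+ 2.
  by rewrite -exprM muln2 -exprD.
have e4 : z ^+ k.+2.*2 = z ^+ 4 * (z ^+ k) ^+ 2.
  by rewrite -exprM muln2 -exprD !doubleS.
have e2 : z ^+ k.+2 = z ^+ 2 * z ^+ k by rewrite -exprD.
split; first by rewrite expf_neq0.
  rewrite /eval2 /map2 /scale2 /= !(hornerD, hornerN, hornerZ, hornerC, hornerXn, hornerX).
  by rewrite !exprVn e2 e3 e4; congr Mat2; field; rewrite ?expf_neq0 ?z0.
rewrite !(hornerD, hornerN, hornerZ, hornerC, hornerXn) !exprVn e2 e4.
by field; rewrite ?expf_neq0 ?z0.
Qed.

End Examples.

(** * Number of ends *)

Section Final.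
Context {R : realType}.

Lemma sphere_with_roots (rs : seq R[i]) (A : bool -> mat2 {poly R[i]})
    (r : bool -> {poly R[i]}) (lam : R[i] -> R[i]) :
  uniq rs ->
  (forall b, null_curve (A b) (r b)) -> (forall b, r b != 0) ->
  (forall z, z != 0 -> [/\ lam z != 0,
     eval2 (A true) z = scale2 (lam z) (eval2 (A false) z^-1) &
     (r true).[z] = lam z * (r false).[z^-1]]) ->
  (forall z, root (r false) z = (z \in rs)) -> root (r true) 0 ->
  exists (S : {fset CP1 R}) (f : CP1 R -> 'rV[R]_3),
    #|` S|%fset = (size rs).+1 /\ bryant_sphere_smooth_ends S f.
Proof.
move=> urs nul r0 glue rsE rinf.
pose S : {fset CP1 R} := [fset x in None :: map Some rs]%fset.
have [||f fS] := sphere_of_null_curves nul r0 glue (S := S).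
- by move=> z; rewrite rsE !inE /= mem_map// => x y [].
- by rewrite rinf !inE.
exists S, f; split => //.
rewrite card_fseq undup_id /= ?size_map// map_inj_uniq => [|x y []//].
by rewrite urs andbT; apply/mapP => -[].
Qed.

(** One root for z^2, and the n distinct roots of unity for z^n - 1 with n >=
    2. *)
Lemma binomial_roots m : exists k eps (rs : seq R[i]),
  [/\ uniq rs, size rs = m.+1 & forall z, root ('X^(k.+2) - eps%:P) z = (z \in rs)].
Proof.
case: m => [|k].
  exists 0%N, 0, [:: 0]; split => // z.
  by rewrite subr0 rootE hornerXn expf_eq0 mem_seq1.
have [rs rsE] := closed_field_poly_normal ('X^(k.+2) - 1 : {poly R[i]}).
have lc : lead_coef ('X^(k.+2) - 1 : {poly R[i]}) = 1.
  by apply/monicP; exact: monicXnsubC.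
rewrite lc scale1r in rsE.
exists k, 1, rs; split.
- rewrite -separable_prod_XsubC -rsE separable_Xn_sub_1// pnatr_eq0//.
- apply: succn_inj; rewrite -(size_prod_XsubC rs id) -rsE.
  by rewrite size_XnsubC.
- by move=> z; rewrite rsE root_prod_XsubC.
Qed.

End Final.

Local Open Scope fset_scope.

Theorem mainTheorem4 (R : realType) (m : nat) (hm : (0 < m)%N) :
  exists (S : {fset CP1 R}) (f : CP1 R -> 'rV[R]_3),
    #|` S| = m /\ bryant_sphere_smooth_ends S f.
Proof.
case: m hm => [//|[_|m _]].
  apply: (@sphere_with_roots _ [::] horosphere_matrix (fun b => if b then 'X else 1)
    (fun z => z)) => //.
  - exact: null_curve_horosphere_matrix.
  - by case; rewrite ?polyX_eq0 ?oner_eq0.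
  - move=> z z0; split => //.
      rewrite /eval2 /map2 /scale2 /= !(hornerN, hornerX, hornerC).
      by rewrite mulfV// mulrN1 mulr1 mulr0.
    by rewrite /= hornerX hornerC mulr1.
  - by move=> z; apply: negbTE; exact: root1.
  - by rewrite rootX.
have [k [eps [rs [urs srs rsE]]]] := binomial_roots (R := R) m.
pose kap : R[i] := k.+2%:R ^+ 2 / k.*2.+3%:R.
have kapE : kap * k.*2.+3%:R = k.+2%:R ^+ 2 by rewrite divfK// pnatr_eq0.
rewrite -srs; apply: (@sphere_with_roots _ rs (binomial_matrix k eps kap) (binomial_root k eps)
  (fun z => z ^+ k.+2.*2)) => //.
- exact: null_curve_binomial_matrix.
- exact: binomial_root_neq0.
- exact: binomial_matrix_glue.
- by rewrite rootE /= hornerD hornerN hornerZ !hornerXn doubleS !exprS !mul0r mulr0 subr0.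
Qed.
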